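(* Let $0<\beta<1$ and let $k=k(n)$ be integers with $1\le k\le n$ and $k=o(n^{1/3})$ as $n\to\infty$. Then the randomized systematic scan dynamics for the Ising model on the complete graph $K_n$ exhibits cutoff at $t_n=\frac{n\log n}{2k(1-\beta)}$ with window size $w_n=n/k$; that is, $w_n=o(t_n)$ and $$\lim_{\gamma\to\infty}\liminf_{n\to\infty} d_n(t_n-\gamma w_n)=1,\qquad \lim_{\gamma\to\infty}\limsup_{n\to\infty} d_n(t_n+\gamma w_n)=0 .$$
   Context: Let $V=\{1,\dots,n\}$, $\Omega=\{-1,+1\}^V$, and let $\beta>0$. The mean-field Ising model (complete graph $K_n$, no external field) is the Gibbs measure $\pi(\sigma)\propto\exp\big(\frac{\beta}{n}\sum_{1\le v<w\le n}\sigma(v)\sigma(w)\big)$ on $\Omega$. The magnetization is $S(\sigma)=\frac1n\sum_{v}\sigma(v)$, and $p_+(x)=\frac{1+\tanh(\beta x)}{2}$. A single-site update of $\sigma$ at $v$ replaces $\sigma(v)$ by $+1$ with probability $p_+(S(\sigma)-\sigma(v)/n)$ and by $-1$ otherwise. The randomized systematic scan dynamics with parameter $k$ is the Markov chain $(X_t)_{t\ge0}$ on $\Omega$ in which, at each time step, $k$ distinct vertices are chosen uniformly at random from $V$ together with a uniformly random ordering $v_1,\dots,v_k$ of them, and single-site updates are performed successively at $v_1,\dots,v_k$ (each with respect to the current configuration), producing $X_{t+1}$. Its stationary distribution is $\pi$. Let $P$ be its transition matrix and $d_n(t)=\max_{\sigma\in\Omega}\|P^t(\sigma,\cdot)-\pi\|_{TV}=\frac12\max_{\sigma}\sum_{\eta}|P^t(\sigma,\eta)-\pi(\eta)|$.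 Non-integer times are understood as rounded to an integer. *)

(* Defs.v *)
From HB Require Import structures.
From mathcomp Require Import all_boot all_order all_algebra.
From mathcomp Require Import all_classical all_reals all_analysis.

Set Implicit Arguments.
Unset Strict Implicit.
Unset Printing Implicit Defensive.

Import Order.TTheory GRing.Theory Num.Theory.
Import numFieldNormedType.Exports.

Local Open Scope classical_set_scope.
Local Open Scope ring_scope.

Section FiniteMarkovChains.
Variables (R : realType) (T : finType).

Definition kid (x y : T) : R := (x == y)%:R.

Definition kcomp (P Q : T -> T -> R) (x z : T) : R := \sum_(y : T) P x y * Q y z.

Definition kpow (P : T -> T -> R) (t : nat) : T -> T -> R := iter t (kcomp P) kid.

Definition tv_dist (mu nu : T -> R) : R := 2^-1 * \sum_(x : T) `|mu x - nu x|.

(* The base point 0 of the maximum is harmless: [tv_dist] is nonnegative. *)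
Definition worst_dist (P : T -> T -> R) (pi : T -> R) (t : nat) : R :=
  \big[Num.max/0]_(x : T) tv_dist (kpow P t x) pi.

End FiniteMarkovChains.

Section Ising.
Variables (R : realType) (n : nat).

(* [true] encodes the spin +1 and [false] the spin -1. *)
Definition config := {ffun 'I_n -> bool}.

Definition spin (b : bool) : R := if b then 1 else -1.

Definition gibbs_weight (beta : R) (s : config) : R :=
  expR (beta / n%:R * \sum_(v < n) \sum_(w < n | (v < w)%N) spin (s v) * spin (s w)).

Definition gibbs (beta : R) (s : config) : R :=
  gibbs_weight beta s / \sum_(s' : config) gibbs_weight beta s'.

Definition magnetization (s : config) : R := n%:R^-1 * \sum_(v < n) spin (s v).

Definition tanh (x : R) : R := (expR x - expR (- x)) / (expR x + expR (- x)).

Definition p_plus (beta x : R) : R := (1 + tanh (beta * x)) / 2.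

Definition set_spin (s : config) (v : 'I_n) (b : bool) : config :=
  [ffun w => if w == v then b else s w].

Definition site_update (beta : R) (v : 'I_n) (s eta : config) : R :=
  let p := p_plus beta (magnetization s - spin (s v) / n%:R) in
  p * (set_spin s v true == eta)%:R + (1 - p) * (set_spin s v false == eta)%:R.

(* Updates at the successive entries of [vs], the head of [vs] first. *)
Definition scan (beta : R) (vs : seq 'I_n) : config -> config -> R :=
  foldr (fun v K => kcomp (site_update beta v) K) (@kid R config) vs.

(* k distinct vertices together with a uniform ordering of them form a uniform
   duplicate-free k-tuple. *)
Definition rss_kernel (beta : R) (k : nat) (s eta : config) : R :=
  (\sum_(vs : k.-tuple 'I_n | uniq vs) scan beta vs s eta)
    / #|[set vs : k.-tuple 'I_n | uniq vs]%SET|%:R.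

Definition rss_dist (beta : R) (k t : nat) : R :=
  worst_dist (rss_kernel beta k) (gibbs beta) t.

End Ising.

(* Non-integer times are rounded down; [Num.truncn] sends negative reals to 0,
   which for w = o(t) and t -> +oo concerns finitely many n for each gamma. *)
Definition cutoff (R : realType) (d : nat -> nat -> R) (t w : nat -> R) : Prop :=
  [/\ w =o_\oo t,
      limn_einf (fun n => (d n (Num.truncn (t n - gamma * w n)))%:E)
        @[gamma --> +oo] --> 1%:E
    & limn_esup (fun n => (d n (Num.truncn (t n + gamma * w n)))%:E)
        @[gamma --> +oo] --> 0%:E].

(* Main.v *)
Require Import Defs.
From HB Require Import structures.
From mathcomp Require Import all_boot all_order all_algebra all_fingroup.
From mathcomp Require Import all_classical all_reals all_analysis.
From mathcomp Require Import ring lra zify.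

Import Order.TTheory GRing.Theory Num.Theory.
Import numFieldNormedType.Exports.

Local Open Scope classical_set_scope.
Local Open Scope ring_scope.

Set Implicit Arguments.
Unset Strict Implicit.
Unset Printing Implicit Defensive.

(** Write [N] for the total spin, [kap = 1 - (1 - beta) k / n], and [P] for the
    operator of one step of the dynamics on test functions.

    Contraction. Under the coupling that scans the same sites in both chains and
    uses maximally coupled bits, the mean of a weighted number of disagreements
    contracts by the factor [kap] per step ([iter_rss_contract]), because [tanh]
    has slope at most 1 and a scan visits each of its sites once. At time
    [t_n + gamma w_n] the chain and a stationary copy therefore differ on average
    in at most [exp (- (1 - beta) gamma) sqrt n] sites. To remove these by
    contraction alone would take another [t_n] steps.

    Smoothing. The law of the chain started from [s0] is invariant under the
    permutations of the sites that fix [s0], so only the numbers of pluses in the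
    two blocks [s0 = +] and [s0 = -] matter. During the last [n / k] steps the
    second chain is run with slightly wrong update probabilities, tilted by
    [delta = lam / sqrt n] towards the first chain, until these two numbers
    agree. There are at most [n] updates, so the relative entropy of the tilted path
    is of order [n delta ^ 2 = lam ^ 2]; and the tilt removes
    [delta n = lam sqrt n] disagreements on average. With
    [lam = exp (- (1 - beta) gamma / 2)] both the entropy and the chance of
    not meeting are small. Instead of measures on paths, the proof propagates the
    dual inequality
      [P^T (ln f) x <= ln (P^T f z) + entropy + chance of not meeting]
    backwards in time, first through the bits of one scan ([scan_tilt]), then
    through the steps ([log_harnack]). Applied to [f = exp (lam h)] it bounds the
    oscillation of [P^T h] by the distance between the profiles of [x] and [z]
    ([profile_smoothing]), to which the contraction applies ([mixing_tv]).

    Lower bound. The one-step drifts of [N] and [N ^ 2] are those of the linear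
    recursion with factor [kap], up to errors that are negligible when
    [k = O(n ^ (1/3))]. From a configuration with [N = q n] one gets, at time [t],
    a mean close to [kap ^ t q n] and a variance that is a small multiple of the
    squared mean plus [O(n)]; under the Gibbs measure [N ^ 2] has mean [O(n)].
    At time [t_n - gamma w_n] the value [kap ^ t q n] is a large multiple of
    [sqrt n], and Chebyshev's inequality separates the two laws ([lower_tv]). *)

(** * The function tanh and logarithmic inequalities *)

Section RealFunctions.
Variable R : realType.
Implicit Types x y a b p q beta lam : R.

Lemma cosh_gt0 x : 0 < expR x + expR (- x).
Proof. by rewrite addr_gt0 ?expR_gt0. Qed.

Lemma tanhN x : tanh (- x) = - tanh x.
Proof. by rewrite /tanh opprK -mulNr opprB; congr (_ / _); exact: addrC. Qed.

Lemma tanhE x : tanh x = 1 - 2 / (expR (2 * x) + 1).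
Proof.
have e0 := expR_gt0 x.
have -> : 2 * x = x + x by ring.
have e1 : expR x * expR x + 1 != 0 by rewrite gt_eqF // addr_gt0 ?mulr_gt0.
rewrite /tanh expRN expRD; field; by rewrite e1 (gt_eqF e0).
Qed.

Lemma is_derive_tanh x : is_derive x 1 (@tanh R) (1 - tanh x ^+ 2).
Proof.
have h0 : expR x + expR (- x) != 0 by rewrite gt_eqF ?cosh_gt0.
rewrite /tanh; apply: is_derive_eq.
rewrite /GRing.scale /=.
by field.
Qed.

(** The slope of [tanh] lies between 0 and 1; the sharp constant 1 is what makes
    [1 - beta] the exact rate of contraction. *)
Lemma tanh_incr_lip a b : a <= b -> 0 <= tanh b - tanh a <= b - a.
Proof.
move=> ab; have [c _ ->] := @MVT_segment R (@tanh R) (fun x => 1 - tanh x ^+ 2) a b ab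
  (fun x _ => is_derive_tanh x)
  (derivable_within_continuous (fun x _ => @ex_derive _ _ _ _ _ _ _ (is_derive_tanh x))).
have t1 : 0 <= 1 - tanh c ^+ 2.
  have := expR_gt0 c; have := expR_gt0 (- c); have := cosh_gt0 c.
  rewrite /tanh; set u := expR c; set v := expR (- c) => s0 v0 u0.
  rewrite expr_div_n subr_ge0 ler_pdivrMr ?exprn_gt0 // mul1r; nra.
have := sqr_ge0 (tanh c); have : 0 <= b - a by lra.
nra.
Qed.

Lemma tanh_lip a b : `|tanh a - tanh b| <= `|a - b|.
Proof.
wlog ab : a b / a <= b => [h|].
  by case: (leP a b) => [/h //|/ltW/h]; rewrite distrC (distrC b).
have /andP[h1 h2] := tanh_incr_lip ab.
by rewrite distrC ger0_norm // distrC ger0_norm //; lra.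
Qed.

Lemma tanh0 : tanh (0 : R) = 0.
Proof. by rewrite /tanh oppr0 subrr mul0r. Qed.

Lemma tanh_norm_le x : `|tanh x| <= `|x|.
Proof. by have := tanh_lip x 0; rewrite tanh0 !subr0. Qed.

Lemma tanh_lt1 x : tanh x < 1.
Proof. by rewrite tanhE ltrBlDr ltrDl divr_gt0 // addr_gt0 // expR_gt0. Qed.

(** Only a quadratic error is claimed, but for every sign of [x]; for negative
    [x] the slope bound already gives [x <= tanh x]. *)
Lemma tanh_ge_quad x : x - x ^+ 2 <= tanh x.
Proof.
have [x0|x0] := leP x 0.
  have := tanh_incr_lip x0; rewrite tanh0; have := sqr_ge0 x; lra.
have h := expR_ge1Dx (2 * x).
rewrite tanhE.
have : 2 / (expR (2 * x) + 1) <= 2 / (2 + 2 * x).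
  by rewrite ler_pM2l // lef_pV2 ?posrE; lra.
have -> : 2 / (2 + 2 * x) = 1 - x / (1 + x) by field; lra.
have : x - x ^+ 2 <= x / (1 + x) by rewrite ler_pdivlMr; [nra|lra].
lra.
Qed.

Lemma p_plus_lip beta x y : 0 <= beta ->
  `|p_plus beta x - p_plus beta y| <= beta / 2 * `|x - y|.
Proof.
move=> b0; rewrite /p_plus.
have -> : (1 + tanh (beta * x)) / 2 - (1 + tanh (beta * y)) / 2 =
  2^-1 * (tanh (beta * x) - tanh (beta * y)) by field.
rewrite normrM ger0_norm; last lra.
have := tanh_lip (beta * x) (beta * y).
rewrite -mulrBr normrM (ger0_norm b0); lra.
Qed.

(** A lower bound on the conditional probability of each bit, since the local
    field divided by [n] stays between -1 and 1. *)
Definition pmin beta : R := (1 - tanh beta) / 2.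

Lemma pmin_gt0 beta : 0 < pmin beta.
Proof. by rewrite /pmin; have := tanh_lt1 beta; lra. Qed.

Lemma p_plus_bounds beta x : 0 <= beta -> `|x| <= 1 ->
  pmin beta <= p_plus beta x <= 1 - pmin beta.
Proof.
move=> b0; rewrite ler_norml => /andP[h1 h2]; rewrite /pmin /p_plus.
have /andP[+ _] : 0 <= tanh beta - tanh (beta * x) <= beta - beta * x.
  by apply: tanh_incr_lip; nra.
have /andP[+ _] : 0 <= tanh (beta * x) - tanh (- beta) <= beta * x - (- beta).
  by apply: tanh_incr_lip; nra.
rewrite tanhN; lra.
Qed.

Lemma expR_le_inv x : x < 1 -> expR x <= (1 - x)^-1.
Proof.
move=> x1; have h : 0 < 1 - x by lra.
rewrite -[x in expR x]opprK expRN lef_pV2 ?posrE ?expR_gt0 //.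
exact: expR_ge1Dx.
Qed.

Lemma expR_le_quad x : 0 <= x <= 1/2 -> expR x <= 1 + x + 2 * x ^+ 2.
Proof.
move=> /andP[x0 x1]; apply: (le_trans (expR_le_inv _)); first lra.
have h : 0 < 1 - x by lra.
rewrite -[_^-1]mul1r ler_pdivrMr //; nra.
Qed.

Lemma ln_le_sub1 x : 0 < x -> ln x <= x - 1.
Proof. by move=> x0; have := @le_ln1Dx R (x - 1); rewrite addrCA subrr addr0; apply; lra. Qed.

(** The Donsker-Varadhan lower bound for a two-point law, with the relative
    entropy of [q] with respect to [p] replaced by the larger chi-square
    divergence: the price of evaluating [ln h] under the wrong probability is
    quadratic in the error. *)
Lemma ln_mean2_change p q h1 h0 : 0 < p < 1 -> 0 <= q <= 1 -> 0 < h1 -> 0 < h0 ->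
  q * ln h1 + (1 - q) * ln h0 <=
  ln (p * h1 + (1 - p) * h0) + (q - p) ^+ 2 / (p * (1 - p)).
Proof.
move=> /andP[p0 p1] /andP[q0 q1] h10 h00.
set m := p * h1 + (1 - p) * h0.
have m0 : 0 < m by rewrite /m; nra.
(* ln u = ln (u p / q) + ln (q / p), each factor bounded by ln y <= y - 1 *)
have key (u pp qq : R) : 0 < u -> 0 < pp -> 0 <= qq ->
    qq * ln u <= pp * u - qq + qq * (qq / pp - 1).
  move=> u0 pp0; rewrite le_eqVlt => /predU1P[<-|qq0].
    by rewrite !mul0r subr0 addr0 mulr_ge0 ?ltW.
  have -> : u = (u * pp / qq) * (qq / pp) by field; rewrite !gt_eqF.
  rewrite lnM ?posrE ?divr_gt0 ?mulr_gt0 // mulrDr.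
  have e1 := @ln_le_sub1 (u * pp / qq) ltac:(by rewrite divr_gt0 ?mulr_gt0).
  have e2 := @ln_le_sub1 (qq / pp) ltac:(by rewrite divr_gt0).
  apply: lerD; last by rewrite ler_pM2l.
  apply: (le_trans (ler_wpM2l (ltW qq0) e1)).
  by rewrite le_eqVlt; apply/orP; left; apply/eqP; field; rewrite !gt_eqF.
have k1 := key (h1 / m) p q ltac:(by rewrite divr_gt0) p0 q0.
have k0 := key (h0 / m) (1 - p) (1 - q) ltac:(by rewrite divr_gt0) ltac:(lra) ltac:(lra).
move: k1 k0; rewrite !ln_div ?posrE // => k1 k0.
have e : p * (h1 / m) + (1 - p) * (h0 / m) = 1.
  by rewrite !mulrA -mulrDl divff // gt_eqF.
have -> : (q - p) ^+ 2 / (p * (1 - p)) = q * (q / p - 1) + (1 - q) * ((1 - q) / (1 - p) - 1).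
  by field; rewrite !gt_eqF; lra.
lra.
Qed.

End RealFunctions.

(** * Uniform duplicate-free sequences of sites *)

Section Averages.
Variables (R : realType) (n : nat).
Implicit Types (k : nat) (f g : seq 'I_n -> R) (F : 'I_n -> R).

Definition uavg k f : R :=
  (\sum_(vs : k.-tuple 'I_n | uniq vs) f vs)
    / #|[set vs : k.-tuple 'I_n | uniq vs]%SET|%:R.

Lemma card_utuples k : #|[set vs : k.-tuple 'I_n | uniq vs]%SET| = (n ^_ k)%N.
Proof.
rewrite -[in RHS](card_ord n) -(card_uniq_tuples k predT).
by apply: eq_card => vs; rewrite !inE all_predT.
Qed.

Lemma card_utuples_gt0 k : (k <= n)%N ->
  0 < (#|[set vs : k.-tuple 'I_n | uniq vs]%SET|%:R : R).
Proof. by move=> kn; rewrite card_utuples ltr0n ffact_gt0. Qed.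

Lemma eq_uavg k f g : (forall vs, uniq vs -> size vs = k -> f vs = g vs) ->
  uavg k f = uavg k g.
Proof.
by move=> h; congr (_ / _); apply: eq_bigr => vs uv; apply: h; rewrite ?size_tuple.
Qed.

Lemma uavg_le k f g : (forall vs, uniq vs -> size vs = k -> f vs <= g vs) ->
  uavg k f <= uavg k g.
Proof.
move=> h; rewrite ler_wpM2r ?invr_ge0 ?ler0n //.
by apply: ler_sum => vs uv; apply: h; rewrite ?size_tuple.
Qed.

Lemma uavgD k f g : uavg k (fun vs => f vs + g vs) = uavg k f + uavg k g.
Proof. by rewrite /uavg big_split mulrDl. Qed.

Lemma uavgZ k c f : uavg k (fun vs => c * f vs) = c * uavg k f.
Proof. by rewrite /uavg -mulr_sumr mulrA. Qed.

Lemma uavg_sum (T : Type) (r : seq T) (P : pred T) k (f : T -> seq 'I_n -> R) :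
  uavg k (fun vs => \sum_(i <- r | P i) f i vs) = \sum_(i <- r | P i) uavg k (f i).
Proof. by rewrite /uavg exchange_big /= mulr_suml. Qed.

Lemma uavg_cst k c : (k <= n)%N -> uavg k (fun _ => c) = c.
Proof.
move=> kn; rewrite /uavg big_const iter_addr_0 /= -[X in c *+ X]/(#|_|).
have -> : #|[pred vs : k.-tuple 'I_n | uniq vs]| = #|[set vs : k.-tuple 'I_n | uniq vs]%SET|.
  by apply: eq_card => vs; rewrite !inE.
by rewrite -[c *+ _]mulr_natr mulfK // gt_eqF // card_utuples_gt0.
Qed.

Lemma uavg_map (g : {perm 'I_n}) k f :
  uavg k (fun vs => f (map g vs)) = uavg k f.
Proof.
congr (_ / _); symmetry.
rewrite (reindex_onto (fun vs : k.-tuple 'I_n => map_tuple g vs)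
  (fun vs : k.-tuple 'I_n => map_tuple (g^-1)%g vs)) /=; last first.
  by move=> vs _; apply: val_inj; rewrite /= -map_comp (eq_map (permKV g)) map_id.
apply: eq_big => [vs|//].
rewrite map_inj_uniq; last exact: perm_inj.
have -> : map_tuple (g^-1)%g (map_tuple g vs) = vs.
  by apply: val_inj; rewrite /= -map_comp (eq_map (permK g)) map_id.
by rewrite eqxx andbT.
Qed.

Lemma sum_mem_uniq (vs : seq 'I_n) F : uniq vs ->
  \sum_(v <- vs) F v = \sum_v (v \in vs)%:R * F v.
Proof.
move=> uv; rewrite (big_uniq _ uv) /= [LHS]big_mkcond /=.
by apply: eq_bigr => v _; case: (v \in vs); rewrite ?mul1r ?mul0r.
Qed.

(** All sites are equally likely to be chosen, and [k] of them are. *)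
Lemma uavg_mem k v : (k <= n)%N -> uavg k (fun vs => (v \in vs)%:R) = k%:R / n%:R.
Proof.
move=> kn; have n0 : (n%:R : R) != 0 by rewrite pnatr_eq0 -lt0n (leq_ltn_trans _ (ltn_ord v)).
have same w : uavg k (fun vs => (w \in vs)%:R) = uavg k (fun vs => (v \in vs)%:R).
  rewrite -(uavg_map (tperm v w)); apply: eq_uavg => vs _ _.
  by rewrite -{1}(tpermL v w) (mem_map (@perm_inj _ _)).
have : uavg k (fun vs => \sum_w (w \in vs)%:R) = k%:R.
  rewrite -[RHS](@uavg_cst k) //; apply: eq_uavg => vs uv <-.
  under eq_bigr do rewrite -[(_)%:R]mulr1.
  by rewrite -sum_mem_uniq // big_const_seq count_predT iter_addr_0.
rewrite uavg_sum; under eq_bigr do rewrite same.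
by rewrite sumr_const card_ord -[_ *+ n]mulr_natr => <-; rewrite mulfK.
Qed.

Lemma uavg_sum_seq k F : (k <= n)%N ->
  uavg k (fun vs => \sum_(v <- vs) F v) = k%:R / n%:R * \sum_v F v.
Proof.
move=> kn; rewrite (@eq_uavg _ _ (fun vs => \sum_v F v * (v \in vs)%:R)); last first.
  by move=> vs uv _; rewrite sum_mem_uniq //; apply: eq_bigr => v _; rewrite mulrC.
rewrite uavg_sum mulr_sumr; apply: eq_bigr => v _.
by rewrite uavgZ uavg_mem // mulrC.
Qed.

(** Sampling without replacement is negatively correlated: by symmetry the
    probability of [v] and [w] being both chosen is the same number [q] for all
    [v != w], and counting ordered pairs gives [q = k (k - 1) / (n (n - 1))]. *)
Lemma uavg_sqr_sum_seq k F : (k <= n)%N -> (forall v, F v ^+ 2 <= 1) ->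
  uavg k (fun vs => (\sum_(v <- vs) F v) ^+ 2)
    <= k%:R + (k%:R / n%:R) ^+ 2 * (\sum_v F v) ^+ 2.
Proof.
move=> kn F1.
have [k0|k0] := posnP k.
  rewrite (@eq_uavg _ _ (fun _ => 0)) ?uavg_cst //; last first.
    by move=> vs _; rewrite k0 => /size0nil ->; rewrite big_nil expr0n.
  by rewrite addr_ge0 ?ler0n // mulr_ge0 ?sqr_ge0.
have n0 : (0 < n)%N := leq_trans k0 kn.
pose ind v (vs : seq 'I_n) : R := (v \in vs)%:R.
pose p : R := k%:R / n%:R; pose q : R := (k%:R - 1) * p / (n%:R - 1).
pose Q v w := uavg k (fun vs => ind v vs * ind w vs).
have Qdiag v : Q v v = p.
  rewrite /Q /p -(uavg_mem v kn); apply: eq_uavg => vs _ _.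
  by rewrite /ind; case: (v \in vs); rewrite ?mulr1 ?mulr0.
have Qrow v : \sum_w Q v w = k%:R * p.
  rewrite /Q -uavg_sum /p -(uavg_mem v kn) -uavgZ; apply: eq_uavg => vs uv <-.
  rewrite -mulr_sumr mulrC; congr (_ * _).
  have := sum_mem_uniq (fun _ => 1) uv; rewrite big_const_seq count_predT iter_addr_0.
  by move=> ->; apply: eq_bigr => w _; rewrite mulr1.
have Qoff v w : w != v -> Q v w = q.
  move=> wv; have same w' : w' != v -> Q v w' = Q v w.
    move=> w'v; rewrite /Q -(uavg_map (tperm w w')); apply: eq_uavg => vs _ _.
    have inv u : (tperm w w' u \in map (tperm w w') vs) = (u \in vs).
      by rewrite (mem_map (@perm_inj _ _)).
    by have := inv w; have := inv v; rewrite /ind tpermL tpermD // => -> ->.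
  have n1 : (n%:R - 1 : R) != 0.
    rewrite subr_eq0 -[1]/(1%:R) eqr_nat; apply: contra wv => /eqP n1.
    by apply/eqP/ord_inj; have hv := ltn_ord v; have hw := ltn_ord w; lia.
  have := Qrow v; rewrite (bigD1 v) //= Qdiag (eq_bigr (fun _ => Q v w)) //.
  rewrite sumr_const (_ : #|_| = n.-1); last first.
    by have := cardC1 v; rewrite card_ord => <-; apply: eq_card => u; rewrite !inE.
  rewrite -[Q v w *+ _]mulr_natr -subn1 natrB // => e.
  by rewrite /q; apply: (mulIf n1); rewrite mulfVK //; move: e; rewrite /=; lra.
have nR : (0 < n%:R :> R) by rewrite ltr0n.
have kR : (1 <= k%:R :> R) by rewrite ler1n.
have knR : (k%:R <= n%:R :> R) by rewrite ler_nat.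
have n1R : (1 <= n%:R :> R) by lra.
have p0 : 0 <= p by rewrite divr_ge0 ?ler0n.
have q0 : 0 <= q by rewrite !mulr_ge0 ?invr_ge0 //; lra.
have qp : q <= p ^+ 2.
  rewrite /q expr2 mulrAC ler_wpM2r //.
  have [n1|n1] := eqVneq (n%:R : R) 1; first by rewrite n1 subrr invr0 mulr0.
  have n2 : 0 < n%:R - 1 :> R by rewrite subr_gt0 lt_neqAle eq_sym n1.
  by rewrite /p ler_pdivrMr // mulrAC ler_pdivlMr //; nra.
rewrite (@eq_uavg _ _ (fun vs => \sum_v \sum_w F v * F w * (ind v vs * ind w vs))); last first.
  move=> vs uv _; rewrite sum_mem_uniq // expr2 mulr_suml; apply: eq_bigr => v _.
  by rewrite mulr_sumr; apply: eq_bigr => w _; rewrite /ind; ring.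
rewrite uavg_sum.
have -> : \sum_i uavg k (fun vs => \sum_w F i * F w * (ind i vs * ind w vs)) =
    (p - q) * \sum_v F v ^+ 2 + q * (\sum_v F v) ^+ 2.
  rewrite expr2 mulr_suml !mulr_sumr -big_split /=; apply: eq_bigr => v _.
  rewrite uavg_sum mulr_sumr (bigD1 v) //= [in RHS](bigD1 v) //= mulrDr.
  rewrite uavgZ -/(Q v v) Qdiag mulr_sumr addrA; congr (_ + _); first by ring.
  by apply: eq_bigr => w wv; rewrite uavgZ -/(Q v w) Qoff // mulrC.
have S0 : 0 <= \sum_v F v ^+ 2 by apply: sumr_ge0 => v _; exact: sqr_ge0.
have Sn : \sum_v F v ^+ 2 <= n%:R.
  by apply: (le_trans (ler_sum _ (fun v _ => F1 v))); rewrite sumr_const card_ord.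
have pn : p * n%:R = k%:R by rewrite /p mulfVK // gt_eqF.
have := sqr_ge0 (\sum_v F v).
rewrite -/p -[X in _ <= X + _]pn.
move: (\sum_v F v ^+ 2) (\sum_v F v) S0 Sn => S2 S S0 Sn hS.
apply: lerD; last by apply: ler_wpM2r.
nra.
Qed.

End Averages.

(** * The scan as an operator on test functions *)

Section Scan.
Variables (R : realType) (n : nat) (beta : R).
Implicit Types (x z s : config n) (v w : 'I_n) (vs : seq 'I_n) (F G : config n -> R) (b c : bool).

Definition local_field x v : R := \sum_(w < n | w != v) spin R (x w).

Definition update_prob x v c : R :=
  let p := p_plus beta (local_field x v / n%:R) in if c then p else 1 - p.

Arguments update_prob : simpl never.

(** The action of a scan on test functions, written as a recursion on the sites
    so that couplings can be built one bit at a time. *)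
Fixpoint scanE vs F x : R :=
  if vs is v :: vs' then
    update_prob x v true * scanE vs' F (set_spin x v true)
      + update_prob x v false * scanE vs' F (set_spin x v false)
  else F x.

Definition rssE k F x : R := uavg k (fun vs => scanE vs F x).

Lemma magnetization_local_field x v :
  magnetization R x - spin R (x v) / n%:R = local_field x v / n%:R.
Proof.
rewrite /magnetization (bigD1 v) //= -/(local_field x v); ring.
Qed.

Lemma site_update_sum v F x : \sum_y site_update beta v x y * F y =
  update_prob x v true * F (set_spin x v true) + update_prob x v false * F (set_spin x v false).
Proof.
rewrite /site_update /update_prob magnetization_local_field; move: (p_plus _ _) => p /=.
have pick s : \sum_y (s == y)%:R * F y = F s.
  rewrite (bigD1 s) //= eqxx mul1r big1 ?addr0 // => y.
  by rewrite eq_sym => /negPf ->; rewrite mul0r.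
under eq_bigr do rewrite mulrDl -!mulrA.
by rewrite big_split /= -!mulr_sumr !pick.
Qed.

Lemma kcomp_sum (T : finType) (P Q : T -> T -> R) (f : T -> R) (x : T) :
  \sum_z Defs.kcomp P Q x z * f z = \sum_y P x y * \sum_z Q y z * f z.
Proof.
under eq_bigr do rewrite mulr_suml.
rewrite exchange_big; apply: eq_bigr => y _; rewrite mulr_sumr.
by apply: eq_bigr => z _; rewrite mulrA.
Qed.

Lemma kid_sum (T : finType) (f : T -> R) (x : T) : \sum_z @kid R T x z * f z = f x.
Proof.
rewrite (bigD1 x) //= /kid eqxx mul1r big1 ?addr0 // => y.
by rewrite eq_sym => /negPf ->; rewrite mul0r.
Qed.

Lemma scan_sum vs F x : \sum_y scan beta vs x y * F y = scanE vs F x.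
Proof.
elim: vs x => [|v vs IH] x; first exact: kid_sum.
rewrite [scan _ _]/= kcomp_sum.
under eq_bigr do rewrite IH.
exact: site_update_sum.
Qed.

Lemma rss_kernel_sum k F x : \sum_y rss_kernel beta k x y * F y = rssE k F x.
Proof.
rewrite /rssE /uavg /rss_kernel.
under eq_bigr do rewrite mulrAC mulr_suml.
rewrite -mulr_suml exchange_big /=; congr (_ / _).
by apply: eq_bigr => vs _; rewrite scan_sum.
Qed.

Lemma kpow_sum k t F x :
  \sum_y kpow (rss_kernel beta k) t x y * F y = iter t (rssE k) F x.
Proof.
elim: t x => [|t IH] x; first exact: kid_sum.
rewrite /kpow iterS -/(kpow _ _) kcomp_sum iterS -rss_kernel_sum.
by apply: eq_bigr => y _; rewrite IH.
Qed.

Lemma update_prob_sum1 x v c : update_prob x v c + update_prob x v (~~ c) = 1.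
Proof. by case: c; rewrite /update_prob /=; ring. Qed.

Lemma scanE_bit c v vs F x : scanE (v :: vs) F x =
  update_prob x v c * scanE vs F (set_spin x v c)
    + update_prob x v (~~ c) * scanE vs F (set_spin x v (~~ c)).
Proof. by case: c => //=; rewrite addrC. Qed.

Lemma spin_norm b : `|spin R b| = 1.
Proof. by case: b; rewrite /spin ?normrN normr1. Qed.

Lemma spin_sqr b : spin R b ^+ 2 = 1.
Proof. by case: b; rewrite /spin ?sqrrN expr1n. Qed.

Lemma local_field_norm x v : `|local_field x v / n%:R| <= 1.
Proof.
have n0 : (0 < n%:R :> R) by rewrite ltr0n (leq_ltn_trans _ (ltn_ord v)).
rewrite normrM [`|_^-1|]gtr0_norm ?invr_gt0 // ler_pdivrMr // mul1r.
apply: (le_trans (ler_norm_sum _ _ _)).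
under eq_bigr do rewrite spin_norm.
rewrite big_mkcond /=; apply: (@le_trans _ _ (\sum_(w < n) 1)).
  by apply: ler_sum => w _; case: ifP.
by rewrite sumr_const card_ord.
Qed.

Hypothesis beta0 : 0 <= beta.

Lemma update_prob_bounds x v c : pmin beta <= update_prob x v c <= 1 - pmin beta.
Proof.
have := p_plus_bounds beta0 (local_field_norm x v); rewrite /update_prob.
by case: c => //; lra.
Qed.

Lemma update_prob_gt0 x v c : 0 < update_prob x v c.
Proof. by have := pmin_gt0 beta; have /andP[] := update_prob_bounds x v c; lra. Qed.

Lemma update_prob_ge0 x v c : 0 <= update_prob x v c. Proof. exact/ltW/update_prob_gt0. Qed.

Lemma update_prob_lip x z v c :
  `|update_prob x v c - update_prob z v c| <= beta / 2 * (`|local_field x v - local_field z v| / n%:R).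
Proof.
have := p_plus_lip (local_field x v / n%:R) (local_field z v / n%:R) beta0.
rewrite -(mulrBl (n%:R)^-1) normrM [`|_^-1|]ger0_norm ?invr_ge0 ?ler0n //.
rewrite /update_prob; case: c => //= h; rewrite distrC; apply: le_trans h.
by rewrite le_eqVlt; apply/orP; left; apply/eqP; congr `|_|; ring.
Qed.

Lemma scanE_le vs F G x : (forall y, F y <= G y) -> scanE vs F x <= scanE vs G x.
Proof.
move=> FG; elim: vs x => [|v vs IH] x //=.
by apply: lerD; apply: ler_wpM2l; rewrite ?update_prob_ge0 ?IH.
Qed.

Lemma scanE_cst vs (a : R) x : scanE vs (fun _ => a) x = a.
Proof.
elim: vs x => [|v vs IH] x //=; rewrite !IH -mulrDl.
by rewrite (update_prob_sum1 x v true) mul1r.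
Qed.

Lemma scanED vs F G x : scanE vs (fun y => F y + G y) x = scanE vs F x + scanE vs G x.
Proof. by elim: vs x => [|v vs IH] x //=; rewrite !IH; ring. Qed.

Lemma scanEZ vs (a : R) F x : scanE vs (fun y => a * F y) x = a * scanE vs F x.
Proof. by elim: vs x => [|v vs IH] x //=; rewrite !IH; ring. Qed.

Lemma rssE_le k F G x : (forall y, F y <= G y) -> rssE k F x <= rssE k G x.
Proof. by move=> FG; apply: uavg_le => vs _ _; apply: scanE_le. Qed.

Lemma rssE_cst k (a : R) x : (k <= n)%N -> rssE k (fun _ => a) x = a.
Proof.
move=> kn; rewrite -[RHS](@uavg_cst R n k) //; apply: eq_uavg => vs _ _.
exact: scanE_cst.
Qed.

Lemma rssED k F G x : rssE k (fun y => F y + G y) x = rssE k F x + rssE k G x.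
Proof. by rewrite -uavgD; apply: eq_uavg => vs _ _; rewrite scanED. Qed.

Lemma rssEZ k (a : R) F x : rssE k (fun y => a * F y) x = a * rssE k F x.
Proof. by rewrite -uavgZ; apply: eq_uavg => vs _ _; rewrite scanEZ. Qed.

Lemma iter_rssE_le k t F G x : (forall y, F y <= G y) ->
  iter t (rssE k) F x <= iter t (rssE k) G x.
Proof. by move=> FG; elim: t x => [//|t IH] x; rewrite !iterS; exact: rssE_le. Qed.

Lemma iter_rssE_cst k t (a : R) x : (k <= n)%N -> iter t (rssE k) (fun _ => a) x = a.
Proof.
move=> kn; elim: t x => [//|t IH] x; rewrite iterS -[RHS](rssE_cst a x kn).
by congr (rssE k _ x); apply: funext => y; exact: IH.
Qed.

Lemma iter_rssED k t F G x : iter t (rssE k) (fun y => F y + G y) x =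
  iter t (rssE k) F x + iter t (rssE k) G x.
Proof.
elim: t x => [//|t IH] x; rewrite !iterS -rssED.
by congr (rssE k _ x); apply: funext => y; exact: IH.
Qed.

Lemma iter_rssEZ k t (a : R) F x :
  iter t (rssE k) (fun y => a * F y) x = a * iter t (rssE k) F x.
Proof.
elim: t x => [//|t IH] x; rewrite !iterS -rssEZ.
by congr (rssE k _ x); apply: funext => y; exact: IH.
Qed.

Definition relabel (g : {perm 'I_n}) x : config n := [ffun v => x (g v)].

Lemma relabel_set_spin g x v b : relabel g (set_spin x v b) = set_spin (relabel g x) ((g^-1)%g v) b.
Proof.
apply/ffunP => w; rewrite !ffunE.
by rewrite (can2_eq (permK g) (permKV g)).
Qed.

Lemma local_field_relabel g x v : local_field (relabel g x) ((g^-1)%g v) = local_field x v.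
Proof.
rewrite /local_field [RHS](reindex_inj (@perm_inj _ g)) /=.
by apply: eq_big => w; rewrite ?ffunE // (can2_eq (permK g) (permKV g)).
Qed.

Lemma scanE_relabel g vs F x :
  scanE vs (fun y => F (relabel g y)) x = scanE (map (g^-1)%g vs) F (relabel g x).
Proof.
elim: vs x => [//|v vs IH] x /=.
by rewrite !IH !relabel_set_spin /update_prob local_field_relabel.
Qed.

Lemma rssE_relabel g k F x : rssE k (fun y => F (relabel g y)) x = rssE k F (relabel g x).
Proof.
rewrite /rssE -[RHS](uavg_map (g^-1)%g).
by apply: eq_uavg => vs _ _; rewrite scanE_relabel.
Qed.

Lemma iter_rssE_relabel g k t F x :
  iter t (rssE k) (fun y => F (relabel g y)) x = iter t (rssE k) F (relabel g x).
Proof.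
elim: t x => [//|t IH] x; rewrite !iterS -rssE_relabel.
by congr (rssE k _ x); apply: funext => y; exact: IH.
Qed.

Lemma jensen_ln_scanE vs F x : (forall y, 0 < F y) ->
  0 < scanE vs F x /\ scanE vs (fun y => ln (F y)) x <= ln (scanE vs F x).
Proof.
move=> F0; elim: vs x => [|v vs IH] x //=.
have [h1 l1] := IH (set_spin x v true); have [h0 l0] := IH (set_spin x v false).
split; first by rewrite addr_gt0 // mulr_gt0 // update_prob_gt0.
have e := update_prob_sum1 x v true; have p1 := update_prob_gt0 x v true; have p0 := update_prob_gt0 x v false.
have := @ln_mean2_change _ (update_prob x v true) (update_prob x v true) _ _ _ _ h1 h0.
rewrite subrr expr0n mul0r addr0 (_ : 1 - update_prob x v true = update_prob x v false); last first.
  by rewrite -[in LHS]e /=; ring.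
move=> h; apply: (le_trans _ (h _ _)); try (simpl in *; lra).
by apply: lerD; rewrite ler_pM2l.
Qed.

End Scan.

Arguments update_prob : simpl never.

(** * Exchangeability and stationarity of the Gibbs measure *)

Section Gibbs.
Variables (R : realType) (n : nat) (beta : R).
Implicit Types (x s : config n) (v w : 'I_n) (F : config n -> R) (b : bool).

Definition spinsum x : R := \sum_(v < n) spin R (x v).

Lemma spinsum_local_field x v : spinsum x = spin R (x v) + local_field R x v.
Proof. by rewrite /spinsum (bigD1 v). Qed.

Lemma local_field_set x v b : local_field R (set_spin x v b) v = local_field R x v.
Proof. by apply: eq_bigr => w wv; rewrite ffunE (negPf wv). Qed.

Lemma spinsum_set x v b : spinsum (set_spin x v b) = spin R b + local_field R x v.
Proof. by rewrite (spinsum_local_field _ v) local_field_set ffunE eqxx. Qed.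

Lemma set_spin_id x v : set_spin x v (x v) = x.
Proof. by apply/ffunP => w; rewrite ffunE; case: eqP => [->|]. Qed.

Lemma set_spin_set x v b b' : set_spin (set_spin x v b) v b' = set_spin x v b'.
Proof. by apply/ffunP => w; rewrite !ffunE; case: eqP. Qed.

Lemma update_prob_set x v b b' : update_prob beta (set_spin x v b) v b' = update_prob beta x v b'.
Proof. by rewrite /update_prob local_field_set. Qed.

Lemma spinsum_relabel g x : spinsum (relabel g x) = spinsum x.
Proof.
rewrite /spinsum [RHS](reindex_inj (@perm_inj _ g)) /=.
by apply: eq_bigr => v _; rewrite ffunE.
Qed.

(** Since spins square to 1, the sum over pairs is a function of the total spin. *)
Lemma gibbs_weightE x :
  gibbs_weight beta x = expR (beta / (2 * n%:R) * (spinsum x ^+ 2 - n%:R)).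
Proof.
rewrite /gibbs_weight; congr expR.
set E2 := \sum_v _.
suff -> : spinsum x ^+ 2 - n%:R = 2 * E2 by rewrite invfM; move: (n%:R^-1) => u; field.
have sq : spinsum x ^+ 2 = \sum_(v < n) \sum_(w < n) spin R (x v) * spin R (x w).
  by rewrite expr2 mulr_suml; apply: eq_bigr => v _; rewrite mulr_sumr.
have split3 v : \sum_(w < n) spin R (x v) * spin R (x w) =
  \sum_(w < n | (v < w)%N) spin R (x v) * spin R (x w) + 1
  + \sum_(w < n | (w < v)%N) spin R (x v) * spin R (x w).
  rewrite (bigID (fun w : 'I_n => (v < w)%N)) /= -addrA; congr (_ + _).
  rewrite (bigD1 v) /=; last by rewrite ltnn.
  rewrite -expr2 spin_sqr; congr (_ + _); apply: eq_bigl => w.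
  by rewrite -leqNgt [RHS]ltn_neqAle andbC.
rewrite sq (eq_bigr _ (fun v _ => split3 v)) !big_split /=.
rewrite [X in _ + X - _](_ : _ = E2); last first.
  rewrite [LHS](exchange_big_dep predT) //=; apply: eq_bigr => v _.
  by apply: eq_bigr => w _; rewrite mulrC.
by rewrite -/E2 sumr_const card_ord; ring.
Qed.

Lemma gibbs_weight_gt0 x : 0 < gibbs_weight beta x.
Proof. exact: expR_gt0. Qed.

Lemma gibbs_mass_gt0 : 0 < \sum_(s : config n) gibbs_weight beta s.
Proof.
rewrite (bigD1 [ffun=> true]) //= ltr_wpDr ?gibbs_weight_gt0 //.
by apply: sumr_ge0 => s _; rewrite ltW ?gibbs_weight_gt0.
Qed.

Lemma gibbs_ge0 x : 0 <= gibbs beta x.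
Proof. by rewrite divr_ge0 // ltW ?gibbs_weight_gt0 ?gibbs_mass_gt0. Qed.

Lemma gibbs_sum1 : \sum_(s : config n) gibbs beta s = 1.
Proof. by rewrite -mulr_suml divff // gt_eqF ?gibbs_mass_gt0. Qed.

Lemma gibbs_relabel g x : gibbs beta (relabel g x) = gibbs beta x.
Proof. by rewrite /gibbs !gibbs_weightE spinsum_relabel. Qed.

Lemma update_prob_true x v : update_prob beta x v true =
  expR (beta * (local_field R x v / n%:R)) /
  (expR (beta * (local_field R x v / n%:R)) + expR (- (beta * (local_field R x v / n%:R)))).
Proof.
rewrite /update_prob /p_plus /tanh.
by field; rewrite gt_eqF ?cosh_gt0.
Qed.

Lemma detailed_balance x v :
  gibbs beta (set_spin x v true) * update_prob beta x v false =
  gibbs beta (set_spin x v false) * update_prob beta x v true.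
Proof.
have n0 : (n%:R : R) != 0.
  by rewrite pnatr_eq0 -lt0n (leq_ltn_trans _ (ltn_ord v)).
have -> : update_prob beta x v false = 1 - update_prob beta x v true by [].
rewrite /gibbs update_prob_true !gibbs_weightE !spinsum_set /spin.
set o := local_field R x v; set Z := \sum_s _.
set a := beta * (o / n%:R).
set c := beta / (2 * n%:R) * (o ^+ 2 + 1 - n%:R).
have -> : beta / (2 * n%:R) * ((1 + o) ^+ 2 - n%:R) = c + a by rewrite /c /a; field.
have -> : beta / (2 * n%:R) * ((-1 + o) ^+ 2 - n%:R) = c + - a by rewrite /c /a; field.
rewrite !expRD; have h := cosh_gt0 a.
have -> : 1 - expR a / (expR a + expR (- a)) = expR (- a) / (expR a + expR (- a)).
  by field; rewrite gt_eqF.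
ring.
Qed.

(** By detailed balance, the defects at a configuration and at its flip at [v]
    cancel. *)
Lemma site_stationary v F :
  \sum_s gibbs beta s * (update_prob beta s v true * F (set_spin s v true)
                         + update_prob beta s v false * F (set_spin s v false))
  = \sum_s gibbs beta s * F s.
Proof.
pose flip s := set_spin s v (~~ s v).
have flipK : involutive flip.
  by move=> s; rewrite /flip set_spin_set ffunE eqxx negbK set_spin_id.
apply/eqP; rewrite -subr_eq0 -sumrB; set S := \sum_s _.
suff : S + S = 0 by move/eqP; rewrite -mulr2n mulrn_eq0.
rewrite {2}/S (reindex_inj (inv_inj flipK)) -big_split big1 //= => s _.
have e := detailed_balance s v; have p1 := update_prob_sum1 beta s v true.
rewrite /flip !set_spin_set !update_prob_set.
have ids := esym (set_spin_id s v).
rewrite [gibbs beta s](congr1 _ ids) [F s](congr1 _ ids) {ids}.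
have -> : update_prob beta s v false = 1 - update_prob beta s v true by rewrite -p1 /=; ring.
move: e; rewrite (_ : update_prob beta s v false = 1 - update_prob beta s v true); last by rewrite -p1 /=; ring.
move: (update_prob beta s v true) => p e; case: (s v) => /=; move: e;
  set mt := gibbs _ (set_spin s v true); set mf := gibbs _ (set_spin s v false);
  move: mt mf (F (set_spin s v true)) (F (set_spin s v false)) => mt mf f1 f2 e.
- transitivity ((f1 - f2) * (mf * p - mt * (1 - p))); first by ring.
  by rewrite e subrr mulr0.
- transitivity ((f1 - f2) * (mf * p - mt * (1 - p))); first by ring.
  by rewrite e subrr mulr0.
Qed.

Lemma scan_stationary vs F :
  \sum_s gibbs beta s * scanE beta vs F s = \sum_s gibbs beta s * F s.
Proof.
elim: vs F => [//|v vs IH] F.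
by rewrite -[RHS]IH -[RHS](site_stationary v).
Qed.

Lemma rss_stationary k F : (k <= n)%N ->
  \sum_s gibbs beta s * rssE beta k F s = \sum_s gibbs beta s * F s.
Proof.
move=> kn; rewrite -[RHS](@uavg_cst R n k) //.
under eq_bigr do rewrite -uavgZ.
rewrite -uavg_sum; apply: eq_uavg => vs _ _; exact: scan_stationary.
Qed.

Lemma iter_rss_stationary k t F : (k <= n)%N ->
  \sum_s gibbs beta s * iter t (rssE beta k) F s = \sum_s gibbs beta s * F s.
Proof. by move=> kn; elim: t => [//|t IH]; rewrite iterS rss_stationary. Qed.

End Gibbs.

(** * Contraction of weighted disagreements *)

Section Contraction.
Variables (R : realType) (n : nat) (beta : R).
Hypothesis beta01 : 0 <= beta <= 1.
Implicit Types (x z : config n) (u v : 'I_n) (vs : seq 'I_n) (w : 'I_n -> R) (G : config n -> R).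

Let beta0 : 0 <= beta. Proof. by case/andP: beta01. Qed.

Definition wdist w x z : R := \sum_v w v * (x v != z v)%:R.

(** The adjoint of an update at [v]: the disagreement at [v] is erased, and a new
    one is produced there with probability at most [beta / n] by each of the
    other disagreements. *)
Definition spread v w : 'I_n -> R :=
  fun u => if u == v then 0 else w u + beta / n%:R * w v.

Lemma wdist_le w x z : (forall v, 0 <= w v) -> wdist w x z <= \sum_v w v.
Proof.
by move=> w0; apply: ler_sum => v _; case: (x v != z v); rewrite ?mulr1 ?mulr0.
Qed.

Lemma local_field_dist x z v :
  `|local_field R x v - local_field R z v| <= 2 * \sum_(u | u != v) (x u != z u)%:R.
Proof.
rewrite -sumrB mulr_sumr; apply: (le_trans (ler_norm_sum _ _ _)).
apply: ler_sum => u _; rewrite /spin.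
case: (x u) (z u) => [] [] /=; rewrite ?subrr ?normr0 ?mulr0 ?mulr1 //.
  by rewrite ger0_norm; lra.
by rewrite ler0_norm; lra.
Qed.

Lemma spread_ge0 v w : (forall u, 0 <= w u) -> forall u, 0 <= spread v w u.
Proof.
move=> w0 u; rewrite /spread; case: eqP => // _.
by rewrite addr_ge0 // mulr_ge0 // divr_ge0.
Qed.

Lemma spread_mass v w : (forall u, 0 <= w u) ->
  \sum_u spread v w u <= \sum_u w u - (1 - beta) * w v.
Proof.
move=> w0; have n0 : 0 < n%:R :> R by rewrite ltr0n (leq_ltn_trans _ (ltn_ord v)).
rewrite [X in X <= _](bigD1 v) //= [X in _ <= X - _](bigD1 v) //= {1}/spread eqxx add0r.
have : \sum_(u | u != v) spread v w u <= \sum_(u | u != v) w u + beta * w v.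
  rewrite (eq_bigr (fun u => w u + beta / n%:R * w v)); last first.
    by move=> u uv; rewrite /spread (negPf uv).
  rewrite big_split lerD2l /=.
  apply: (@le_trans _ _ (\sum_(u < n) beta / n%:R * w v)).
    rewrite big_mkcond /=; apply: ler_sum => u _; case: ifP => // _.
    by rewrite mulr_ge0 // divr_ge0.
  rewrite sumr_const card_ord -[_ *+ n]mulr_natr.
  by rewrite le_eqVlt; apply/orP; left; apply/eqP; field; rewrite gt_eqF.
lra.
Qed.

(** Maximal coupling of the two bits at [v], written as a functional
    inequality; the bits differ with probability at most
    [beta / n] times the number of other disagreements. *)
Lemma site_contract v w G (c0 : R) : (forall u, 0 <= w u) ->
  (forall x z, G x - G z <= c0 + wdist w x z) -> forall x z,
  scanE beta [:: v] G x - scanE beta [:: v] G z <= c0 + wdist (spread v w) x z.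
Proof.
move=> w0 h x z; rewrite /=.
set N := \sum_(u | u != v) (x u != z u)%:R : R.
set d := \sum_(u | u != v) w u * (x u != z u)%:R : R.
have hd b b' : G (set_spin x v b) - G (set_spin z v b') <= c0 + (d + w v * (b != b')%:R).
  apply: (le_trans (h _ _)); rewrite lerD2l /wdist (bigD1 v) //= !ffunE eqxx addrC.
  rewrite lerD2r le_eqVlt; apply/orP; left; apply/eqP.
  by apply: eq_bigr => u uv; rewrite !ffunE (negPf uv).
have -> : wdist (spread v w) x z = d + beta / n%:R * w v * N.
  rewrite /wdist (bigD1 v) //= {1}/spread eqxx mul0r add0r /d /N mulr_sumr -big_split /=.
  by apply: eq_bigr => u uv; rewrite /spread (negPf uv); ring.
have hp : `|update_prob beta x v true - update_prob beta z v true| <= beta / n%:R * N.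
  apply: (le_trans (update_prob_lip beta0 _ _ _ _)).
  have := local_field_dist x z v; rewrite -/N => hN.
  have ni : 0 <= (n%:R)^-1 :> R by rewrite invr_ge0.
  rewrite (_ : beta / n%:R * N = beta / 2 * ((2 * N) * (n%:R)^-1)); last by move: (n%:R)^-1 => i; field.
  by apply: ler_wpM2l; [rewrite divr_ge0|apply: ler_wpM2r].
have htt := hd true true; have hff := hd false false.
have htf := hd true false; have hft := hd false true.
rewrite ?eqxx /= ?mulr0 ?mulr1 in htt hff htf hft.
have p0 := update_prob_ge0 beta0 x v true; have q0 := update_prob_ge0 beta0 z v true.
have p1 := update_prob_sum1 beta x v true; have q1 := update_prob_sum1 beta z v true.
have p2 := update_prob_ge0 beta0 x v false; have q2 := update_prob_ge0 beta0 z v false.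
have wv := w0 v; rewrite /= in p1 q1.
have m1 : `|update_prob beta x v true - update_prob beta z v true| * w v <= beta / n%:R * w v * N.
  by rewrite mulrAC; apply: ler_wpM2r.
move: p0 q0 p1 q1 p2 q2 m1 => {hp}.
move: (update_prob _ x v true) (update_prob _ x v false) (update_prob _ z v true) (update_prob _ z v false) => p p' q q'.
move: (G (set_spin x v true)) (G (set_spin x v false)) htt hff htf hft => s1 s2.
move: (G (set_spin z v true)) (G (set_spin z v false)) => t1 t2 htt hff htf hft.
move=> p0 q0 p1 q1 p2 q2; move: (_ * w v * N) => X.
have -> : p' = 1 - p by lra.
have -> : q' = 1 - q by lra.
have [pq|pq] := leP q p.
  rewrite ger0_norm => [hX|]; last lra.
  have pq0 : 0 <= p - q by lra.
  have p'0 : 0 <= 1 - p by lra.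
  have := ler_wpM2l q0 htt; have := ler_wpM2l pq0 htf; have := ler_wpM2l p'0 hff; lra.
rewrite ltr0_norm => [hX|]; last lra.
have pq0 : 0 <= q - p by lra.
have q'0 : 0 <= 1 - q by lra.
have := ler_wpM2l p0 htt; have := ler_wpM2l pq0 hft; have := ler_wpM2l q'0 hff; lra.
Qed.

Lemma foldr_spread_ge0 vs w : (forall u, 0 <= w u) ->
  forall u, 0 <= foldr spread w vs u.
Proof. by move=> w0; elim: vs => //= v vs IH; exact: spread_ge0. Qed.

Lemma foldr_spread_ge vs w v : (forall u, 0 <= w u) -> v \notin vs ->
  w v <= foldr spread w vs v.
Proof.
move=> w0; elim: vs => //= u vs IH; rewrite inE negb_or => /andP[vu vvs].
rewrite /spread (negPf vu); apply: (le_trans (IH vvs)); rewrite lerDl.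
by rewrite mulr_ge0 ?divr_ge0 // foldr_spread_ge0.
Qed.

(** Since each scanned site is visited once, its weight at the moment of its
    update is at least its initial one; hence a scan loses exactly the rate
    [1 - beta] on every visited site, with no error from the scan order. *)
Lemma foldr_spread_mass vs w : (forall u, 0 <= w u) -> uniq vs ->
  \sum_u foldr spread w vs u <= \sum_u w u - (1 - beta) * \sum_(v <- vs) w v.
Proof.
move=> w0; elim: vs => [|v vs IH] /=; first by rewrite big_nil mulr0 subr0.
move=> /andP[vvs /IH {}IH]; rewrite big_cons.
have := spread_mass v (foldr_spread_ge0 vs w0).
have := foldr_spread_ge w0 vvs; have /andP[_ b1] := beta01.
move: (foldr spread w vs v) (\sum_u spread _ _ _) => y Y y1 y2.
have : (1 - beta) * w v <= (1 - beta) * y by apply: ler_wpM2l; lra.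
lra.
Qed.

Lemma scan_contract vs w G (c0 : R) : (forall u, 0 <= w u) ->
  (forall x z, G x - G z <= c0 + wdist w x z) -> forall x z,
  scanE beta vs G x - scanE beta vs G z <= c0 + wdist (foldr spread w vs) x z.
Proof.
move=> w0 h; elim: vs => [|v vs IH] //.
exact: (@site_contract v _ (scanE beta vs G)) (foldr_spread_ge0 vs w0) IH.
Qed.

Lemma rss_contract k w G (c0 : R) : (k <= n)%N -> (forall u, 0 <= w u) ->
  (forall x z, G x - G z <= c0 + wdist w x z) ->
  exists w', [/\ forall u, 0 <= w' u,
    \sum_u w' u <= (1 - (1 - beta) * (k%:R / n%:R)) * \sum_u w u
  & forall x z, rssE beta k G x - rssE beta k G z <= c0 + wdist w' x z].
Proof.
move=> kn w0 h; exists (fun u => uavg k (fun vs => foldr spread w vs u)); split.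
- move=> u; rewrite -(@uavg_cst R n k 0) //; apply: uavg_le => vs _ _.
  exact: foldr_spread_ge0.
- rewrite -uavg_sum.
  apply: (@le_trans _ _ (uavg k (fun vs => \sum_u w u + - (1 - beta) * \sum_(v <- vs) w v))).
    by apply: uavg_le => vs uv _; rewrite mulNr; exact: foldr_spread_mass.
  rewrite uavgD uavg_cst // uavgZ uavg_sum_seq //.
  by rewrite le_eqVlt; apply/orP; left; apply/eqP; ring.
move=> x z.
have -> : wdist (fun u => uavg k (fun vs => foldr spread w vs u)) x z =
    uavg k (fun vs => wdist (foldr spread w vs) x z).
  rewrite [RHS]uavg_sum; apply: eq_bigr => v _.
  by rewrite mulrC -uavgZ; apply: eq_uavg => vs _ _; rewrite mulrC.
rewrite /rssE -mulN1r -uavgZ -uavgD -[X in _ <= X + _](@uavg_cst R n k c0) // -uavgD.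
by apply: uavg_le => vs _ _; rewrite mulN1r; exact: scan_contract.
Qed.

Lemma contraction_ge0 k : (k <= n)%N -> 0 <= 1 - (1 - beta) * (k%:R / n%:R) :> R.
Proof.
move=> kn; have [n0|n0] := posnP n; first by rewrite n0 invr0 !mulr0 subr0.
have : k%:R / n%:R <= 1 :> R by rewrite ler_pdivrMr ?ltr0n // mul1r ler_nat.
have : 0 <= k%:R / n%:R :> R by rewrite divr_ge0.
have /andP[] := beta01; nra.
Qed.

(** Started from any two configurations, the weighted disagreement is at most
    the total mass of the weight transported backwards in time, which does not
    refer to the configurations. *)
Lemma iter_rss_contract k t w G (c0 : R) : (k <= n)%N -> (forall u, 0 <= w u) ->
  (forall x z, G x - G z <= c0 + wdist w x z) -> forall x z,
  iter t (rssE beta k) G x - iter t (rssE beta k) G z <=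
    c0 + (1 - (1 - beta) * (k%:R / n%:R)) ^+ t * \sum_u w u.
Proof.
move=> kn w0 h.
have kap0 := contraction_ge0 kn.
suff [w' [w'0 m' h']] : exists w', [/\ forall u, 0 <= w' u,
    \sum_u w' u <= (1 - (1 - beta) * (k%:R / n%:R)) ^+ t * \sum_u w u
  & forall x z, iter t (rssE beta k) G x - iter t (rssE beta k) G z <= c0 + wdist w' x z].
  move=> x z; apply: (le_trans (h' x z)); rewrite lerD2l.
  exact: (le_trans (wdist_le _ _ w'0)).
elim: t => [|t [w1 [w10 m1 h1]]]; first by exists w; rewrite expr0 mul1r; split.
have [w2 [w20 m2 h2]] := rss_contract kn w10 h1.
exists w2; split => //; apply: (le_trans m2).
by rewrite exprS -mulrA; apply: ler_wpM2l.
Qed.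


End Contraction.

(** * A coupling of two scans by change of measure *)

Section TiltedCoupling.
Variables (R : realType) (n : nat) (beta : R) (s0 : config n).
Hypothesis beta01 : 0 <= beta <= 1.
Implicit Types (x z : config n) (u v : 'I_n) (vs : seq 'I_n) (F H : config n -> R) (b c : bool).

Let beta0 : 0 <= beta. Proof. by case/andP: beta01. Qed.

Definition blk_size b : nat := #|[pred v | s0 v == b]|.
Definition blk_wt b : R := (blk_size b)%:R^-1.
Definition blk_diff b x z : R := \sum_(v | s0 v == b) ((z v)%:R - (x v)%:R).

(** On profiles [(U, V)] = (number of pluses on [s0 = +], on [s0 = -]) this is
    the l1 distance with each coordinate scaled by the size of its block. *)
Definition profile_dist x z : R := \sum_(b : bool) blk_wt b * `|blk_diff b x z|.

Definition ndisc b vs x z : nat := count (fun v => (s0 v == b) && (x v != z v)) vs.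
Definition nagree b vs x z : nat := count (fun v => (s0 v == b) && (x v == z v)) vs.

Arguments ndisc : simpl never.
Arguments nagree : simpl never.

(** A bound on the expected excess left in a block of excess [e] when [N] sites
    remain, at each of which a positive excess drops by one with probability
    [delta]. The factor 1/2 pays for the excess possibly reaching 0 early. *)
Definition resid (delta : R) (e N : nat) : R :=
  if e == 0 then 0 else e%:R - delta / 2 * N%:R.

Lemma resid_step (delta : R) (e N : nat) : 0 <= delta -> N.+1%:R * delta <= 1 ->
  (1 - delta) * resid delta e.+1 N + delta * resid delta e N <= resid delta e.+1 N.+1.
Proof.
move=> d0; rewrite /resid /=; rewrite -[e.+1%:R]natr1 -[N.+1%:R]natr1 => h.
case: eqP => [->|_]; last lra.
rewrite mulr0n add0r; have N0 := ler0n R N; have := ler_wpM2l d0 h; have := mulr_ge0 d0 d0; lra.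
Qed.

(** One bit of the coupled scan: the second chain uses the probability [p - d]
    instead of its own [pz], and its bit is coupled monotonically with that of the
    first chain; [d] is then the probability that the two bits differ. *)
Lemma tilt_step (p pz d f1 f0 h1 h0 Ps Pd : R) : 0 < pz < 1 -> 0 <= d <= p -> p <= 1 ->
  0 < h1 -> 0 < h0 -> f1 <= ln h1 + Ps -> f0 <= ln h0 + Ps ->
  d * f1 <= d * (ln h0 + Pd) ->
  p * f1 + (1 - p) * f0 <= ln (pz * h1 + (1 - pz) * h0)
    + (p - d - pz) ^+ 2 / (pz * (1 - pz)) + ((1 - d) * Ps + d * Pd).
Proof.
move=> pz01 /andP[d0 dp] p1 h10 h00 a1 a0 ad.
have q01 : 0 <= p - d <= 1 by apply/andP; split; lra.
have := ln_mean2_change pz01 q01 h10 h00.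
have q0 : 0 <= p - d by lra.
have p'0 : 0 <= 1 - p by lra.
have := ler_wpM2l q0 a1; have := ler_wpM2l p'0 a0.
move: ad; set C := (_ / _); lra.
Qed.

Lemma blk_diff_set b v c c' x z :
  blk_diff b (set_spin x v c) (set_spin z v c') =
  blk_diff b x z - (s0 v == b)%:R * (((z v)%:R - (x v)%:R) - (c'%:R - c%:R)).
Proof.
rewrite /blk_diff; case vb : (s0 v == b); last first.
  rewrite mul0r subr0; apply: eq_bigr => u ub; rewrite !ffunE.
  by case: eqP => // uv; rewrite uv vb in ub.
rewrite (bigD1 v) //= [in RHS](bigD1 v) //= !ffunE eqxx mul1r.
rewrite (eq_bigr (fun u => (z u)%:R - (x u)%:R)); first by ring.
by move=> u /andP[_ uv]; rewrite !ffunE (negPf uv).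
Qed.

Lemma ndisc_set b v c c' vs x z : v \notin vs ->
  ndisc b vs (set_spin x v c) (set_spin z v c') = ndisc b vs x z.
Proof.
move=> vvs; apply: eq_in_count => u uvs; rewrite !ffunE.
by case: (eqVneq u v) => // uv; rewrite -uv uvs in vvs.
Qed.

Lemma nagree_set b v c c' vs x z : v \notin vs ->
  nagree b vs (set_spin x v c) (set_spin z v c') = nagree b vs x z.
Proof.
move=> vvs; apply: eq_in_count => u uvs; rewrite !ffunE.
by case: (eqVneq u v) => // uv; rewrite -uv uvs in vvs.
Qed.

Lemma local_field_blk_diff x z v :
  local_field R z v - local_field R x v =
  2 * (\sum_(b : bool) blk_diff b x z - ((z v)%:R - (x v)%:R)).
Proof.
have -> : \sum_(b : bool) blk_diff b x z = \sum_u ((z u)%:R - (x u)%:R).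
  rewrite [RHS](bigID (fun u => s0 u == true)) /= big_bool /=; congr (_ + _).
  by apply: eq_bigl => u; case: (s0 u).
rewrite (bigD1 v) //= addrAC subrr add0r -sumrB mulr_sumr.
by apply: eq_bigr => u _; rewrite /spin; case: (x u) (z u) => [] [] /=; ring.
Qed.

Variables (delta A : R) (F H : config n -> R) (K0 K1 : R).
Hypothesis delta0 : 0 <= delta.
Hypothesis delta_p : delta <= pmin beta.
Hypothesis A1 : 1 <= A.
Hypothesis A_delta : 2 * A / n%:R <= delta.
Hypothesis H0 : forall y, 0 < H y.
Hypothesis K1_ge0 : 0 <= K1.
Hypothesis FH : forall x z, F x <= ln (H z) + K0 + K1 * profile_dist x z.

Let cost : R := (2 * delta) ^+ 2 / pmin beta ^+ 2.

(** The two chains see fields that differ by at most [4 A / n], so the tilted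
    probability is within [2 delta] of the true one. *)
Lemma tilt_cost x z v c d : 0 <= d <= delta ->
  \sum_(b : bool) `|blk_diff b x z| <= A ->
  (update_prob beta x v c - d - update_prob beta z v c) ^+ 2 / (update_prob beta z v c * (1 - update_prob beta z v c)) <= cost.
Proof.
move=> /andP[d0 dd] hA.
have n0 : 0 < n%:R :> R by rewrite ltr0n (leq_ltn_trans _ (ltn_ord v)).
have pm := pmin_gt0 beta.
have /andP[q0 q1] := update_prob_bounds beta0 z v c.
have hp : `|update_prob beta x v c - update_prob beta z v c| <= delta.
  apply: (le_trans (update_prob_lip beta0 _ _ _ _)); apply: le_trans A_delta.
  have ho : `|local_field R x v - local_field R z v| <= 2 * (2 * A).
    rewrite distrC local_field_blk_diff normrM ger0_norm // ler_pM2l //.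
    apply: (le_trans (ler_normB _ _)).
    apply: (@le_trans _ _ (A + 1)); last by have a1 := A1; lra.
    apply: lerD; first by apply: (le_trans (ler_norm_sum _ _ _)).
    by case: (z v) (x v) => [] [] /=; rewrite ?subrr ?subr0 ?sub0r ?normrN ?normr0 ?normr1.
  have ni : 0 < (n%:R)^-1 :> R by rewrite invr_gt0.
  have : `|local_field R x v - local_field R z v| / n%:R <= 2 * (2 * A) / n%:R by rewrite ler_pM2r.
  have /andP[_ b1] := beta01; have b0 := beta0.
  have : 0 <= `|local_field R x v - local_field R z v| / n%:R by rewrite divr_ge0.
  move: (`|_| / _) => X X0 XA.
  have : beta / 2 * X <= 1 / 2 * X by apply: ler_wpM2r => //; lra.
  move: XA; rewrite -!mulrA; move: (A / _) => Y; lra.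
have sq : (update_prob beta x v c - d - update_prob beta z v c) ^+ 2 <= (2 * delta) ^+ 2.
  rewrite -[X in X <= _]real_normK ?num_real // ler_sqr ?nnegrE //; last lra.
  move: hp; rewrite !ler_norml; move=> /andP[? ?]; apply/andP; split; lra.
apply: ler_pM => //; first exact: sqr_ge0.
  by rewrite invr_ge0 mulr_ge0 //; lra.
have le2 : pmin beta ^+ 2 <= update_prob beta z v c * (1 - update_prob beta z v c).
  by rewrite expr2; apply: ler_pM; lra.
have pm2 : 0 < pmin beta ^+ 2 by rewrite exprn_gt0.
by rewrite lef_pV2 ?posrE //; exact: lt_le_trans le2.
Qed.

Variable o : bool -> bool.

(** Two scans of the same sites [vs] are coupled. A visited disagreement is always
    removed by using equal bits. The excess [e b] is the discrepancy between the
    numbers of pluses in block [b] that equal bits would leave at the end of the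
    scan; while it is positive, each visited agreement is used to lower it by one
    with probability [delta]. Since the sites of a scan are distinct, the
    discrepancy never changes sign.
    [F] and [ln H] play the roles of the two sides of the inequality at the
    later times, and [cost] is the entropy of one tilted bit. *)
Lemma scan_tilt vs (e : bool -> nat) x z : uniq vs -> (size vs)%:R * delta <= 1 ->
  (forall v, v \in vs -> x v != z v -> z v = o (s0 v)) ->
  (forall b, spin R (o b) * blk_diff b x z = (e b + ndisc b vs x z)%:R) ->
  \sum_(b : bool) (e b + ndisc b vs x z)%:R <= A ->
  scanE beta vs F x <= ln (scanE beta vs H z) + K0
    + K1 * (\sum_(b : bool) blk_wt b * resid delta (e b) (nagree b vs x z))
    + (size vs)%:R * cost.
Proof.
have dl0 := delta0; have dlp := delta_p.
have blk_norm vs' (e' : bool -> nat) x' z' b :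
    spin R (o b) * blk_diff b x' z' = (e' b + ndisc b vs' x' z')%:R ->
    `|blk_diff b x' z'| = (e' b + ndisc b vs' x' z')%:R.
  by move=> h; rewrite -normr_nat -h normrM spin_norm mul1r.
elim: vs e x z => [|v vs IH] e x z.
  move=> _ _ _ hd _; rewrite mul0r addr0; apply: (le_trans (FH x z)).
  rewrite lerD2l le_eqVlt; apply/orP; left; apply/eqP; congr (_ * _).
  apply: eq_bigr => b _; congr (_ * _).
  rewrite (blk_norm _ _ _ _ _ (hd b)) /resid /ndisc /nagree /= addn0.
  by rewrite mulr0 subr0; case: eqP => // ->.
rewrite cons_uniq [size _]/= => /andP[vvs uvs] hsz hor hd hA.
have hsz' : (size vs)%:R * delta <= 1.
  by apply: le_trans hsz; apply: ler_wpM2r => //; rewrite ler_nat.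
have hA0 : \sum_(b : bool) `|blk_diff b x z| <= A.
  apply: le_trans hA; apply: ler_sum => b _.
  by rewrite (blk_norm _ _ _ _ _ (hd b)).
set b0 := s0 v; set ob := o b0.
(* the tail of the scan after the bits c, c' have been written at v *)
have tail (e' : bool -> nat) c c' :
    (forall b, spin R (o b) * blk_diff b (set_spin x v c) (set_spin z v c') =
       (e' b + ndisc b vs x z)%:R) ->
    (forall b, (e' b + ndisc b vs x z <= e b + ndisc b (v :: vs) x z)%N) ->
    scanE beta vs F (set_spin x v c) <= ln (scanE beta vs H (set_spin z v c'))
      + (K0 + K1 * (\sum_(b : bool) blk_wt b * resid delta (e' b) (nagree b vs x z))
         + (size vs)%:R * cost).
  move=> hd' hle.
  have := IH e' (set_spin x v c) (set_spin z v c') uvs hsz'.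
  have -> : \sum_(b : bool) blk_wt b * resid delta (e' b)
        (nagree b vs (set_spin x v c) (set_spin z v c')) =
      \sum_(b : bool) blk_wt b * resid delta (e' b) (nagree b vs x z).
    by apply: eq_bigr => b _; rewrite nagree_set.
  rewrite !addrA; apply.
  - move=> u uvs'; rewrite !ffunE; case: (eqVneq u v) => [uv|_]; first by rewrite -uv uvs' in vvs.
    by apply: hor; rewrite inE uvs' orbT.
  - by move=> b; rewrite ndisc_set // hd'.
  apply: le_trans hA; apply: ler_sum => b _; rewrite ndisc_set // ler_nat; exact: hle.
have [h10 _] := jensen_ln_scanE beta0 vs (set_spin z v ob) H0.
have [h00 _] := jensen_ln_scanE beta0 vs (set_spin z v (~~ ob)) H0.
rewrite (scanE_bit beta ob) (scanE_bit beta ob v vs H).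
have prN y : update_prob beta y v (~~ ob) = 1 - update_prob beta y v ob by rewrite -(update_prob_sum1 beta y v ob); ring.
rewrite !prN.
have pm := pmin_gt0 beta.
have /andP[p0 p1] := update_prob_bounds beta0 x v ob.
have /andP[q0 q1] := update_prob_bounds beta0 z v ob.
have pz01 : 0 < update_prob beta z v ob < 1 by apply/andP; split; lra.
have p1' : update_prob beta x v ob <= 1 by lra.
have szE : (size vs).+1%:R * cost = (size vs)%:R * cost + cost by rewrite -natr1; ring.
(* without tilt, for a disagreement or for a block whose excess is 0 *)
have untilted :
    (forall b c, spin R (o b) * blk_diff b (set_spin x v c) (set_spin z v c) =
       (e b + ndisc b vs x z)%:R) ->
    (forall b, resid delta (e b) (nagree b vs x z) <= resid delta (e b) (nagree b (v :: vs) x z)) ->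
    update_prob beta x v ob * scanE beta vs F (set_spin x v ob)
      + (1 - update_prob beta x v ob) * scanE beta vs F (set_spin x v (~~ ob))
    <= ln (update_prob beta z v ob * scanE beta vs H (set_spin z v ob)
           + (1 - update_prob beta z v ob) * scanE beta vs H (set_spin z v (~~ ob))) + K0
       + K1 * (\sum_(b : bool) blk_wt b * resid delta (e b) (nagree b (v :: vs) x z))
       + (size vs).+1%:R * cost.
  move=> hd' hres.
  have hle b : (e b + ndisc b vs x z <= e b + ndisc b (v :: vs) x z)%N.
    by rewrite leq_add2l /ndisc /= leq_addl.
  have t1 := tail e ob ob (fun b => hd' b ob) hle.
  have t0 := tail e (~~ ob) (~~ ob) (fun b => hd' b (~~ ob)) hle.
  have d01 : 0 <= (0 : R) <= update_prob beta x v ob by apply/andP; split; lra.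
  have := tilt_step (Pd := 0) pz01 d01 p1' h10 h00 t1 t0; rewrite !mul0r => /(_ (lexx _)).
  have := @tilt_cost x z v ob 0; rewrite lexx => /(_ delta0 hA0).
  rewrite szE; set C := (_ ^+ 2 / _).
  have : K1 * (\sum_(b : bool) blk_wt b * resid delta (e b) (nagree b vs x z)) <=
         K1 * (\sum_(b : bool) blk_wt b * resid delta (e b) (nagree b (v :: vs) x z)).
    apply: ler_wpM2l => //; apply: ler_sum => b _; apply: ler_wpM2l => //.
    by rewrite invr_ge0.
  lra.
have [xz|xz] := eqVneq (x v) (z v); last first.
  (* a disagreement: equal bits remove it *)
  have zv : z v = ob by apply: hor => //; rewrite inE eqxx.
  have xv : x v = ~~ ob by move: xz; rewrite zv /ob; case: (x v) (o b0) => [] [].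
  apply: untilted => [b c|b]; last first.
    rewrite le_eqVlt; apply/orP; left; apply/eqP; congr resid.
    by rewrite /nagree /= (negPf xz) andbF.
  rewrite blk_diff_set mulrBr hd subrr subr0 zv xv /ndisc /= xz andbT -/b0.
  case: eqP => [<-|_]; last by rewrite mul0r mulr0 subr0 add0n.
  by rewrite mul1r addnCA natrD /ob /spin; case: (o b0) => /=; ring.
have ndE b : ndisc b (v :: vs) x z = ndisc b vs x z by rewrite /ndisc /= xz eqxx andbF.
have naE b : nagree b (v :: vs) x z = ((b0 == b) + nagree b vs x z)%N.
  by rewrite /nagree /= xz eqxx andbT.
have hdsame b c : spin R (o b) * blk_diff b (set_spin x v c) (set_spin z v c) =
    (e b + ndisc b vs x z)%:R.
  by rewrite blk_diff_set xz !subrr mulr0 subr0 hd ndE.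
have [e0|e0] := posnP (e b0).
  (* nothing left to remove in this block *)
  apply: untilted => [b c|b]; first exact: hdsame.
  by rewrite naE; case: eqP => [<-|_]; rewrite ?add0n // /resid e0.
(* tilt: with probability delta the second chain gets the bit opposite to the first *)
pose e' b := if b == b0 then (e b).-1 else e b.
have hle b : (e b + ndisc b vs x z <= e b + ndisc b (v :: vs) x z)%N by rewrite ndE.
have hle' b : (e' b + ndisc b vs x z <= e b + ndisc b (v :: vs) x z)%N.
  by rewrite ndE leq_add2r /e'; case: ifP => // _; exact: leq_pred.
have t1 := tail e ob ob (fun b => hdsame b ob) hle.
have t0 := tail e (~~ ob) (~~ ob) (fun b => hdsame b (~~ ob)) hle.
have td : scanE beta vs F (set_spin x v ob) <= ln (scanE beta vs H (set_spin z v (~~ ob)))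
      + (K0 + K1 * (\sum_(b : bool) blk_wt b * resid delta (e' b) (nagree b vs x z))
         + (size vs)%:R * cost).
  apply: tail hle' => b; rewrite blk_diff_set xz subrr mulrBr hd ndE /e' -/b0 [b == b0]eq_sym.
  case: eqP => [<-|_]; last by rewrite mul0r mulr0 subr0.
  rewrite -{1}(prednK e0) addSn -natr1 /ob /spin.
  by case: (o b0) => /=; ring.
have d01 : 0 <= delta <= update_prob beta x v ob by apply/andP; split; lra.
have := tilt_step pz01 d01 p1' h10 h00 t1 t0 (ler_wpM2l delta0 td).
have := @tilt_cost x z v ob delta; rewrite lexx andbT => /(_ delta0 hA0).
rewrite szE; set C := (_ ^+ 2 / _).
have : K1 * ((1 - delta) * (\sum_(b : bool) blk_wt b * resid delta (e b) (nagree b vs x z))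
          + delta * (\sum_(b : bool) blk_wt b * resid delta (e' b) (nagree b vs x z)))
    <= K1 * (\sum_(b : bool) blk_wt b * resid delta (e b) (nagree b (v :: vs) x z)).
  apply: ler_wpM2l => //; rewrite !mulr_sumr -big_split /=; apply: ler_sum => b _.
  rewrite (mulrCA (1 - delta)) (mulrCA delta) -mulrDr.
  apply: ler_wpM2l; first by rewrite invr_ge0.
  rewrite naE /e' [b == b0]eq_sym; case: eqP => [<-|_]; last by rewrite add0n; lra.
  rewrite add1n -{1 3}(prednK e0); apply: resid_step => //.
  apply: le_trans hsz; apply: ler_wpM2r => //; rewrite ler_nat /= ltnS.
  exact: count_size.
lra.
Qed.

End TiltedCoupling.

(** * Profile distance after one step *)

Section Smoothing.
Variables (R : realType) (n : nat) (beta : R) (s0 : config n).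
Hypothesis beta01 : 0 <= beta <= 1.
Implicit Types (x z y : config n) (u v : 'I_n) (vs : seq 'I_n) (F H : config n -> R) (b c : bool) (k : nat).

Let beta0 : 0 <= beta. Proof. by case/andP: beta01. Qed.

Lemma uavg_ln k (f : seq 'I_n -> R) : (k <= n)%N ->
  (forall vs, uniq vs -> size vs = k -> 1 <= f vs) ->
  uavg k (fun vs => ln (f vs)) <= ln (uavg k f).
Proof.
move=> kn f1; set m := uavg k f.
have m1 : 1 <= m by rewrite -(@uavg_cst R n k 1) //; exact: uavg_le.
have m0 : 0 < m by lra.
apply: (@le_trans _ _ (uavg k (fun vs => (ln m - 1) + m^-1 * f vs))).
  apply: uavg_le => vs uv sv; have f0 : 0 < f vs by have := f1 _ uv sv; lra.
  have := @ln_le_sub1 R (m^-1 * f vs); rewrite mulr_gt0 ?invr_gt0 // => /(_ isT).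
  rewrite lnM ?posrE ?invr_gt0 // lnV ?posrE //; lra.
rewrite uavgD uavg_cst // uavgZ -/m mulVf ?gt_eqF //; lra.
Qed.

Lemma scanE_ge1 vs H x : (forall y, 1 <= H y) -> 1 <= scanE beta vs H x.
Proof. by move=> H1; rewrite -[X in X <= _](scanE_cst beta vs 1 x); exact: scanE_le. Qed.

Lemma iter_rssE_ge k t (a : R) H x : (k <= n)%N -> (forall y, a <= H y) ->
  a <= iter t (rssE beta k) H x.
Proof.
by move=> kn H1; rewrite -[X in X <= _](iter_rssE_cst beta t a x kn); exact: iter_rssE_le.
Qed.

Lemma iter_rssE_ub k t (a : R) H x : (k <= n)%N -> (forall y, H y <= a) ->
  iter t (rssE beta k) H x <= a.
Proof.
by move=> kn H1; rewrite -[X in _ <= X](iter_rssE_cst beta t a x kn); exact: iter_rssE_le.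
Qed.

Lemma rssE_ln k H x : (k <= n)%N -> (forall y, 1 <= H y) ->
  rssE beta k (fun y => ln (H y)) x <= ln (rssE beta k H x).
Proof.
move=> kn H1; apply: le_trans (@uavg_ln k _ kn _); last first.
  by move=> vs _ _; exact: scanE_ge1.
apply: uavg_le => vs _ _.
have H0 y : 0 < H y by exact: lt_le_trans (H1 y).
by have [_] := jensen_ln_scanE beta0 vs x H0.
Qed.

Lemma iter_rssE_ln k t H x : (k <= n)%N -> (forall y, 1 <= H y) ->
  iter t (rssE beta k) (fun y => ln (H y)) x <= ln (iter t (rssE beta k) H x).
Proof.
move=> kn H1; elim: t x => [//|t IH] x; rewrite !iterS.
apply: (le_trans (rssE_le beta0 _ _ IH)); apply: rssE_ln => // y.
exact: iter_rssE_ge.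
Qed.

Local Notation stab g := (relabel g s0 == s0).

Lemma blk_diff_relabel g b x z : stab g -> blk_diff R s0 b x (relabel g z) = blk_diff R s0 b x z.
Proof.
move=> /eqP gs; rewrite /blk_diff !sumrB; congr (_ - _).
rewrite [RHS](reindex_inj (@perm_inj _ g)) /=; apply: eq_big => v; last by rewrite ffunE.
by rewrite -{1}gs ffunE.
Qed.

Lemma profile_dist_relabel g x z : stab g ->
  profile_dist R s0 x (relabel g z) = profile_dist R s0 x z.
Proof. by move=> gs; apply: eq_bigr => b _; rewrite blk_diff_relabel. Qed.

Lemma relabel_relabel g h x : relabel g (relabel h x) = relabel (g * h)%g x.
Proof. by apply/ffunP => v; rewrite !ffunE permM. Qed.

(** The disagreements of a block all point the same way, so that their number is
    the difference of the numbers of pluses. *)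
Definition ordered (o : bool -> bool) x z := forall v, x v != z v -> z v = o (s0 v).

(** Take the representative of the orbit of [z] nearest to [x] in Hamming
    distance: two opposite disagreements in one block could be cancelled by
    transposing their sites. *)
Lemma ordered_rep x z : exists g, stab g /\ exists o, ordered o x (relabel g z).
Proof.
pose ham g := #|[pred v | x v != relabel g z v]|.
have act1 y : relabel 1%g y = y by apply/ffunP => v; rewrite ffunE perm1.
have s1 : stab 1%g by rewrite act1.
case: (@arg_minnP _ 1%g (fun g => stab g) ham s1) => g gs gmin; exists g; split => //.
set z' := relabel g z.
have nocross u v : s0 u = s0 v -> x u != z' u -> x v != z' v -> z' u = z' v.
  move=> uv xu xv; apply/eqP; apply: contraT => zuv.
  have ts : stab (tperm u v * g)%g.
    rewrite -relabel_relabel (eqP gs); apply/eqP/ffunP => i; rewrite ffunE.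
    by case: tpermP => [->|->|].
  have /= := gmin _ ts; rewrite leqNgt => /negP; case.
  apply: proper_card; apply/properP; split.
    apply/fintype.subsetP => i; rewrite !inE -relabel_relabel -/z' ffunE.
    case: tpermP => [->|->|//]; rewrite ?xu ?xv //.
  exists u; rewrite !inE // -relabel_relabel -/z' ffunE tpermL negbK.
  by move: xu zuv; case: (x u) (z' u) (z' v) => [] [] [].
exists (fun b => [exists v, [&& s0 v == b, x v != z' v & z' v]]) => v xv.
case zv : (z' v); first by symmetry; apply/existsP; exists v; rewrite eqxx xv zv.
symmetry; apply/existsP => -[u /and3P[/eqP uv xu zu]].
by have := nocross u v uv xu xv; rewrite zu zv.
Qed.

Definition blk_disc b x z : nat := #|[pred v | (s0 v == b) && (x v != z v)]|.

Lemma ordered_blk_diff o b x z : ordered o x z ->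
  spin R (o b) * blk_diff R s0 b x z = (blk_disc b x z)%:R.
Proof.
move=> oxz; rewrite /blk_diff /blk_disc mulr_sumr -sum1_card natr_sum.
rewrite big_mkcond [RHS]big_mkcond /=; apply: eq_bigr => v _; rewrite !inE.
case: eqP => //= vb; case: eqVneq => [->|xz]; first by rewrite subrr mulr0.
have := oxz v xz; rewrite vb; move: xz; rewrite /spin.
by case: (x v) (z v) (o b) => [] [] [] //= _ _; ring.
Qed.

Lemma ordered_norm_blk_diff o b x z : ordered o x z ->
  `|blk_diff R s0 b x z| = (blk_disc b x z)%:R :> R.
Proof. by move=> /(ordered_blk_diff b) h; rewrite -normr_nat -h normrM spin_norm mul1r. Qed.

Lemma ordered_profile_dist o x z : ordered o x z ->
  profile_dist R s0 x z = \sum_(b : bool) blk_wt R s0 b * (blk_disc b x z)%:R.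
Proof. by move=> oxz; apply: eq_bigr => b _; rewrite (ordered_norm_blk_diff b oxz). Qed.

Lemma ndisc_le b vs x z : uniq vs -> (ndisc s0 b vs x z <= blk_disc b x z)%N.
Proof.
move=> uv; rewrite /ndisc -size_filter /blk_disc cardE.
apply: uniq_leq_size; first exact: filter_uniq.
by move=> v; rewrite mem_filter mem_enum => /andP[].
Qed.

Lemma ndisc_nagree b vs x z :
  (ndisc s0 b vs x z + nagree s0 b vs x z)%:R = \sum_(v <- vs) (s0 v == b)%:R :> R.
Proof.
elim: vs => [|v vs IH]; first by rewrite big_nil.
rewrite big_cons -IH /ndisc /nagree /= -!natrD; congr _%:R.
by case: (s0 v == b); case: (x v == z v) => /=; lia.
Qed.

(** Each visited site of a block with disagreements contributes at least
    [delta / 2]: either it is a disagreement, or the tilt acts there; and when the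
    excess is 0 the whole block gets matched, a gain of at least 1. *)
Lemma resid_le (delta : R) b vs x z : 0 <= delta <= 1 -> uniq vs ->
  (size vs)%:R * delta <= 1 ->
  resid delta (blk_disc b x z - ndisc s0 b vs x z) (nagree s0 b vs x z) <=
  (blk_disc b x z)%:R - delta / 2 * ((0 < blk_disc b x z)%N%:R * \sum_(v <- vs) (s0 v == b)%:R).
Proof.
move=> /andP[d0 d1] uv hsz; have := ndisc_le b x z uv.
rewrite -(ndisc_nagree b vs x z) /resid natrD.
set a := blk_disc b x z; set d := ndisc _ _ _ _ _; set m := nagree _ _ _ _ _ => da.
have dm : (d + m <= size vs)%N.
  have := ndisc_nagree b vs x z; rewrite -/d -/m.
  rewrite -(count_predC (fun v => s0 v == b) vs) => /eqP h.
  apply: leq_trans (leq_addr _ _); rewrite -(ler_nat R) (eqP h).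
  by rewrite -sum1_count natr_sum [X in _ <= X]big_mkcond /=; apply: ler_sum => v _; case: ifP.
have hdm : (d%:R + m%:R) * delta <= 1.
  by apply: le_trans hsz; rewrite -natrD; apply: ler_wpM2r => //; rewrite ler_nat.
have d0' := ler0n R d; have m0' := ler0n R m.
have [a0|a0] := posnP a.
  by move: da; rewrite a0 leqn0 => /eqP ->; rewrite mul0r mulr0 subr0.
rewrite mul1r; case: eqP => [e|_].
  have : (1 : R) <= a%:R by rewrite ler1n.
  lra.
rewrite natrB //; have := ler_wpM2r d0' d1; lra.
Qed.

Lemma blk_wt_ge0 b : 0 <= blk_wt R s0 b.
Proof. by rewrite invr_ge0. Qed.

Lemma sum_blk_ind b : \sum_v (s0 v == b)%:R = (blk_size s0 b)%:R :> R.
Proof.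
rewrite /blk_size -sum1_card natr_sum [RHS]big_mkcond /=.
by apply: eq_bigr => v _; rewrite !inE; case: ifP.
Qed.

(** Averaged over the sites, a block with disagreements loses [delta / 2] times
    the expected proportion [k / n] of its sites, whatever its size. *)
Lemma rss_tilt k (delta A K0 K1 : R) F H o x z : (k <= n)%N ->
  0 <= delta <= 1 -> delta <= pmin beta -> k%:R * delta <= 1 -> 0 <= K1 ->
  (forall y, 1 <= H y) ->
  (forall x z, F x <= ln (H z) + K0 + K1 * profile_dist R s0 x z) ->
  ordered o x z -> (exists b, (0 < blk_disc b x z)%N) ->
  2 * (\sum_(b : bool) (blk_disc b x z)%:R) / n%:R <= delta ->
  rssE beta k F x <= ln (rssE beta k H z) + K0
    + K1 * (profile_dist R s0 x z - delta / 2 * (k%:R / n%:R))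
    + k%:R * ((2 * delta) ^+ 2 / pmin beta ^+ 2).
Proof.
move=> kn d01 dp kd K10 H1 FH oxz [b0 b0p] hA.
have /andP[d0 d1] := d01.
set cost := (_ / pmin beta ^+ 2).
set a := fun b => blk_disc b x z.
have H0 y : 0 < H y by exact: lt_le_trans (H1 y).
pose S vs : R := \sum_(b : bool) blk_wt R s0 b *
  ((a b)%:R - delta / 2 * ((0 < a b)%N%:R * \sum_(v <- vs) (s0 v == b)%:R)).
have A1 : 1 <= \sum_(b : bool) (a b)%:R :> R.
  rewrite (bigD1 b0) //=; apply: (@le_trans _ _ (a b0)%:R); first by rewrite ler1n.
  by rewrite lerDl sumr_ge0.
apply: (@le_trans _ _ (uavg k (fun vs => ln (scanE beta vs H z) + (K0 + K1 * S vs + k%:R * cost)))).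
  apply: uavg_le => vs uv sv; rewrite !addrA.
  have := @scan_tilt R n beta s0 beta01 delta _ F H K0 K1 d0 dp A1 hA H0 K10 FH o vs
    (fun b => a b - ndisc s0 b vs x z)%N x z uv.
  rewrite sv => /(_ kd (fun v _ => oxz v)) h.
  apply: (le_trans (h _ _)) => [b||].
  - by rewrite subnK ?ndisc_le // (ordered_blk_diff b oxz).
  - by apply: ler_sum => b _; rewrite subnK ?ndisc_le.
  rewrite -/cost lerD2r lerD2l; apply: ler_wpM2l => //; apply: ler_sum => b _.
  apply: ler_wpM2l; first exact: blk_wt_ge0.
  by apply: resid_le; rewrite ?sv.
rewrite uavgD -!addrA; apply: lerD.
  by apply: uavg_ln => // vs _ _; exact: scanE_ge1.
rewrite !uavgD !uavg_cst // addrA lerD2r lerD2l uavgZ.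
apply: ler_wpM2l => //.
rewrite /S uavg_sum (ordered_profile_dist oxz) -/a.
have avgE b : uavg k (fun vs => blk_wt R s0 b *
    ((a b)%:R - delta / 2 * ((0 < a b)%N%:R * \sum_(v <- vs) (s0 v == b)%:R))) =
    blk_wt R s0 b * (a b)%:R - delta / 2 * (k%:R / n%:R) * (0 < a b)%N%:R.
  rewrite (@eq_uavg _ _ _ _ (fun vs => blk_wt R s0 b * (a b)%:R +
    - (delta / 2 * (0 < a b)%N%:R * blk_wt R s0 b) * \sum_(v <- vs) (s0 v == b)%:R)); last first.
    by move=> vs _ _; ring.
  rewrite uavgD uavg_cst // uavgZ uavg_sum_seq // sum_blk_ind.
  case: posnP => [_|ab]; first by rewrite (_ : false%:R = 0 :> R) //; ring.
  have sb : (blk_size s0 b)%:R != 0 :> R.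
    rewrite pnatr_eq0 -lt0n; apply: leq_trans ab _; apply: subset_leq_card.
    by apply/fintype.subsetP => v; rewrite !inE => /andP[].
  rewrite !mulr1 mulNr; congr (_ - _).
  transitivity (delta / 2 * (k%:R / n%:R) * (blk_wt R s0 b * (blk_size s0 b)%:R)); first by ring.
  by rewrite /blk_wt mulVf // mulr1.
rewrite (eq_bigr _ (fun b _ => avgE b)) sumrB; apply: lerB; first by [].
rewrite -mulr_sumr.
rewrite -[X in X <= _]mulr1; apply: ler_wpM2l.
  by rewrite mulr_ge0 ?divr_ge0.
rewrite (bigD1 b0) //= b0p lerDl; exact: sumr_ge0.
Qed.

End Smoothing.

(** * Log-Harnack inequality and the upper bound *)

Section UpperBound.
Variables (R : realType) (n : nat) (beta : R) (s0 : config n).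
Hypothesis beta01 : 0 <= beta <= 1.
Hypothesis n_gt0 : (0 < n)%N.
Implicit Types (x z y : config n) (u v : 'I_n) (b c : bool).

Let beta0 : 0 <= beta. Proof. by case/andP: beta01. Qed.
Let nR0 : 0 < n%:R :> R. Proof. by rewrite ltr0n. Qed.

Local Notation stab g := (relabel g s0 == s0).
Local Notation D := (profile_dist R s0).

Lemma profile_dist_ge0 x z : 0 <= D x z.
Proof. by apply: sumr_ge0 => b _; rewrite mulr_ge0 // blk_wt_ge0. Qed.

Lemma blk_wt_disc b x z :
  (blk_disc s0 b x z)%:R <= n%:R * (blk_wt R s0 b * (blk_disc s0 b x z)%:R).
Proof.
have [d0|d0] := posnP (blk_disc s0 b x z); first by rewrite d0 !mulr0.
have sb : (0 < blk_size s0 b)%N.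
  apply: leq_trans d0 _; apply: subset_leq_card.
  by apply/fintype.subsetP => v; rewrite !inE => /andP[].
have sbn : (blk_size s0 b <= n)%N by rewrite -[n in (_ <= n)%N]card_ord; exact: max_card.
rewrite mulrA -[X in X <= _]mul1r; apply: ler_wpM2r => //.
by rewrite /blk_wt ler_pdivlMr ?ltr0n // mul1r ler_nat.
Qed.

Section OneRound.
Variables (k : nat) (delta lam : R) (f : config n -> R).
Hypothesis k_gt0 : (0 < k)%N.
Hypothesis kn : (k <= n)%N.
Hypothesis delta_gt0 : 0 < delta.
Hypothesis delta_p : delta <= pmin beta.
Hypothesis k_delta : k%:R * delta <= 1.
Hypothesis lam_ge0 : 0 <= lam.
Hypothesis f_ge1 : forall y, 1 <= f y.
Hypothesis f_le : forall y, ln (f y) <= lam.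
Hypothesis f_act : forall g y, stab g -> f (relabel g y) = f y.

Local Notation P := (rssE beta k).
Let cost : R := k%:R * ((2 * delta) ^+ 2 / pmin beta ^+ 2).
Let rho : R := delta / 2 * (k%:R / n%:R).

(** The log-Harnack inequality. A path of the second chain is tilted so as to
    meet the first one; the entropy of the tilt is at most [cost] per step, and
    the expected profile distance loses [rho] per step while it is positive, so
    that the chance of not having met after [T] steps is at most
    [profile_dist x z / (rho * T)]. The meeting probability never has to be
    formed: the right-hand side is a supersolution of the one-step recursion. *)
Lemma log_harnack T x z : (0 < T)%N -> (T * k <= n)%N ->
  iter T P (fun y => ln (f y)) x <=
  ln (iter T P f z) + T%:R * cost + lam * D x z / (rho * T%:R).
Proof.
have d0 := delta_gt0; have l0 := lam_ge0; have n0 := nR0.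
have kR : 1 <= k%:R :> R by rewrite ler1n.
have d1 : delta <= 1.
  by apply: le_trans k_delta; rewrite -[X in X <= _]mul1r; apply: ler_wpM2r => //; exact: ltW.
have rho0 : 0 < rho by rewrite /rho mulr_gt0 ?divr_gt0 // ltr0n.
have cost0 : 0 <= cost by rewrite /cost mulr_ge0 // divr_ge0 ?sqr_ge0.
have trivial_bound T' x' z' : D x' z' >= rho * T'.+1%:R ->
    iter T'.+1 P (fun y => ln (f y)) x' <=
    ln (iter T'.+1 P f z') + T'.+1%:R * cost + lam * D x' z' / (rho * T'.+1%:R).
  move=> hD.
  have h1 : iter T'.+1 P (fun y => ln (f y)) x' <= lam by exact: iter_rssE_ub.
  have h2 : 0 <= ln (iter T'.+1 P f z') by rewrite ln_ge0 // iter_rssE_ge.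
  have h3 : 0 <= T'.+1%:R * cost by rewrite mulr_ge0.
  have h4 : lam <= lam * D x' z' / (rho * T'.+1%:R).
    by rewrite -mulrA ler_peMr // ler_pdivlMr ?mul1r // mulr_gt0 // ltr0n.
  by apply: (le_trans h1); apply: (le_trans h4); rewrite lerDr addr_ge0.
pose goal T' x' z' := iter T' P (fun y => ln (f y)) x' <=
    ln (iter T' P f z') + T'%:R * cost + lam * D x' z' / (rho * T'%:R).
(* it is enough to treat the representative of the orbit of z nearest to x *)
have reduce T' : (forall o x' z', ordered s0 o x' z' -> goal T' x' z') ->
    forall x' z', goal T' x' z'.
  move=> h x' z'; have [g [hg [ori oxz]]] := ordered_rep s0 x' z'.
  have := h ori _ _ oxz; rewrite /goal (profile_dist_relabel R x' z' hg) -iter_rssE_relabel.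
  rewrite (_ : (fun y => f (relabel g y)) = f) //.
  by apply: funext => y; exact: f_act.
have nodisc T' x' z' : (forall b, blk_disc s0 b x' z' = 0%N) -> goal T' x' z'.
  move=> h0; have -> : x' = z'.
    apply/ffunP => v; apply/eqP; apply: contraT => xv.
    by have := card0_eq (h0 (s0 v)) v; rewrite !inE eqxx xv.
  have hj := @iter_rssE_ln R n beta beta01 k T' f z' kn f_ge1.
  have h1 : 0 <= T'%:R * cost by exact: mulr_ge0.
  have h2 : 0 <= lam * D z' z' / (rho * T'%:R).
    by apply: divr_ge0; apply: mulr_ge0 => //; [exact: profile_dist_ge0|exact: ltW].
  by apply: (le_trans hj); rewrite -addrA lerDl addr_ge0.
have dichotomy x' z' : (forall b, blk_disc s0 b x' z' = 0%N) \/
    exists b, (0 < blk_disc s0 b x' z')%N.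
  case: (posnP (blk_disc s0 true x' z')) => [t0|]; last by right; exists true.
  case: (posnP (blk_disc s0 false x' z')) => [f0|]; last by right; exists false.
  by left=> -[].
rewrite -/(goal T x z); case: T => // T _.
elim: T x z => [|T IH] x z hT; apply: reduce => o {}x {}z oxz;
  (have [|[b0 b0p]] := dichotomy x z; first exact: nodisc).
  (* a positive profile distance is at least 1 / n *)
- apply: trivial_bound; rewrite mulr1 (ordered_profile_dist R oxz).
  have hb : 1 <= \sum_(b : bool) n%:R * (blk_wt R s0 b * (blk_disc s0 b x z)%:R).
    rewrite (bigD1 b0) //=; apply: (@le_trans _ _ (blk_disc s0 b0 x z)%:R); first by rewrite ler1n.
    apply: (le_trans (blk_wt_disc _ _ _)); rewrite lerDl; apply: sumr_ge0 => b _.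
    by rewrite !mulr_ge0 // blk_wt_ge0.
  rewrite -mulr_sumr in hb.
  move: hb; rewrite /rho mulrA ler_pdivrMr //; move: (\sum_b _) => X hb.
  have hk := k_delta; lra.
have [hD|hD] := leP (rho * T.+2%:R) (D x z); first exact: trivial_bound.
have Tk : (T.+1 * k <= n)%N by apply: leq_trans hT; rewrite leq_mul2r leqnSn orbT.
have hA : 2 * (\sum_(b : bool) (blk_disc s0 b x z)%:R) / n%:R <= delta.
  have h : \sum_(b : bool) (blk_disc s0 b x z)%:R <= n%:R * D x z.
    by rewrite (ordered_profile_dist R oxz) mulr_sumr; apply: ler_sum => b _; exact: blk_wt_disc.
  have h2 : n%:R * (rho * T.+2%:R) <= delta / 2 * n%:R.
    have -> : n%:R * (rho * T.+2%:R) = delta / 2 * (T.+2 * k)%:R.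
      by rewrite /rho natrM; field; rewrite gt_eqF.
    by apply: ler_wpM2l; [lra|rewrite ler_nat].
  have h3 : n%:R * D x z <= n%:R * (rho * T.+2%:R) by apply: ler_wpM2l; exact: ltW.
  by rewrite ler_pdivrMr //; lra.
have K10 : 0 <= lam / (rho * T.+1%:R) by rewrite divr_ge0 // mulr_ge0 // ltW.
have := @rss_tilt R n beta s0 beta01 k delta 0 (T.+1%:R * cost) (lam / (rho * T.+1%:R))
  (iter T.+1 P (fun y => ln (f y))) (iter T.+1 P f) o x z kn
  ltac:(by rewrite ltW) delta_p k_delta K10 ltac:(by move=> y; exact: iter_rssE_ge) _ oxz
  (ex_intro _ b0 b0p) hA.
rewrite -/cost -/rho => /(_ _)/le_trans; apply.
  by move=> x' z'; rewrite mulrAC; exact: IH.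
rewrite -[T.+2%:R]natr1.
have t0 : 0 < T.+1%:R :> R by rewrite ltr0n.
rewrite -[T.+2%:R]natr1 in hD.
have key : (rho * T.+1%:R)^-1 * (D x z - rho) <= D x z / (rho * (T.+1%:R + 1)).
  move: hD; move: (T.+1%:R) t0 => t t0 hD.
  have t1 : 0 < t + 1 by lra.
  have rt : 0 < rho * t by exact: mulr_gt0.
  rewrite mulrC ler_pdivrMr //.
  rewrite (_ : D x z / (rho * (t + 1)) * (rho * t) = D x z * t / (t + 1)); last first.
    by field; rewrite !gt_eqF.
  by rewrite ler_pdivlMr //; lra.
have kk := ler_wpM2l l0 key; rewrite !mulrA in kk.
rewrite -iterS (mulrDl _ _ cost) mul1r.
by rewrite [_ + cost]addrAC -[_ + _ + cost]addrA lerD2l.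
Qed.

End OneRound.

Section Mixing.
Variables (k T : nat) (delta lam : R).
Hypothesis k_gt0 : (0 < k)%N.
Hypothesis kn : (k <= n)%N.
Hypothesis delta_gt0 : 0 < delta.
Hypothesis delta_p : delta <= pmin beta.
Hypothesis k_delta : k%:R * delta <= 1.
Hypothesis lam01 : 0 < lam <= 1 / 2.
Hypothesis T_gt0 : (0 < T)%N.
Hypothesis Tk : (T * k <= n)%N.

Local Notation P := (rssE beta k).
Let cost : R := k%:R * ((2 * delta) ^+ 2 / pmin beta ^+ 2).
Let rho : R := delta / 2 * (k%:R / n%:R).
Let err : R := 2 * lam + T%:R * cost / lam.

(** The log-Harnack inequality for [exp (lam h)] becomes a bound on the
    oscillation of [h], as in the proof of Pinsker's inequality. *)
Lemma profile_smoothing (h : config n -> R) x z :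
  (forall y, 0 <= h y <= 1) -> (forall g y, stab g -> h (relabel g y) = h y) ->
  iter T P h x - iter T P h z <= err + (rho * T%:R)^-1 * D x z.
Proof.
move=> h01 hact; have /andP[l0 l1] := lam01.
pose f y := expR (lam * h y).
have f1 y : 1 <= f y.
  by rewrite -[X in X <= _]expR0 ler_expR mulr_ge0 ?(ltW l0) //; have /andP[] := h01 y.
have lnf y : ln (f y) = lam * h y by rewrite expRK.
have flam y : ln (f y) <= lam.
  by rewrite lnf -[X in _ <= X]mulr1 ler_pM2l //; have /andP[] := h01 y.
have fact' g y : stab g -> f (relabel g y) = f y by move=> hg; rewrite /f hact.
have := log_harnack k_gt0 kn delta_gt0 delta_p k_delta (ltW l0) f1 flam fact' x z T_gt0 Tk.
rewrite (_ : (fun y => ln (f y)) = fun y => lam * h y); last exact: funext.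
rewrite iter_rssEZ -/cost -/rho => main.
have fz : iter T P f z <= 1 + 2 * lam ^+ 2 + lam * iter T P h z.
  rewrite -(iter_rssE_cst beta T (1 + 2 * lam ^+ 2) z kn) -iter_rssEZ -iter_rssED.
  apply: iter_rssE_le => // y; have /andP[y0 y1] := h01 y.
  apply: (le_trans (@expR_le_quad R (lam * h y) _)); first by apply/andP; split; nra.
  have : (lam * h y) ^+ 2 <= lam ^+ 2.
    by rewrite ler_sqr ?nnegrE ?mulr_ge0 ?(ltW l0) // -[X in _ <= X]mulr1 ler_pM2l.
  lra.
have fz0 : 0 < iter T P f z := lt_le_trans ltr01 (iter_rssE_ge beta01 T z kn f1).
have lnfz := ln_le_sub1 fz0.
rewrite -(ler_pM2l l0) /err mulrBr !mulrDr.
have -> : lam * (T%:R * cost / lam) = T%:R * cost by rewrite mulrC mulfVK // gt_eqF.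
have -> : lam * ((rho * T%:R)^-1 * D x z) = lam * D x z / (rho * T%:R).
  by rewrite mulrCA mulrC.
move: main lnfz fz; move: (ln _) (T%:R * cost) (_ / _) => L X Y; lra.
Qed.

Lemma profile_dist_wdist x z : D x z <= wdist (fun v => blk_wt R s0 (s0 v)) x z.
Proof.
rewrite /wdist (bigID (fun v => s0 v == true)) /= /profile_dist big_bool /=.
have half b : blk_wt R s0 b * `|blk_diff R s0 b x z| <=
    \sum_(v | s0 v == b) blk_wt R s0 (s0 v) * (x v != z v)%:R.
  rewrite -(ger0_norm (blk_wt_ge0 R s0 b)) -normrM mulr_sumr.
  apply: (le_trans (ler_norm_sum _ _ _)); apply: ler_sum => v /eqP ->.
  rewrite normrM (ger0_norm (blk_wt_ge0 R s0 b)).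
  apply: ler_wpM2l; first exact: blk_wt_ge0.
  by case: (x v) (z v) => [] [] /=; rewrite ?subrr ?subr0 ?sub0r ?normrN ?normr0 ?normr1.
apply: lerD; first exact: half.
rewrite (eq_bigl (fun v => s0 v == false)); first exact: half.
by move=> v; case: (s0 v).
Qed.

Lemma sum_blk_wt_le2 : \sum_v blk_wt R s0 (s0 v) <= 2.
Proof.
have half b : \sum_(v | s0 v == b) blk_wt R s0 (s0 v) <= 1.
  rewrite (eq_bigr (fun=> blk_wt R s0 b)); last by move=> v /eqP ->.
  rewrite sumr_const -/(blk_size s0 b) -mulr_natl /blk_wt.
  have [->|sb] := posnP (blk_size s0 b); first by rewrite mul0r.
  by rewrite divff // pnatr_eq0 -lt0n.
rewrite (bigID (fun v => s0 v == true)) /= (_ : 2 = 1 + 1) //.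
apply: lerD; first exact: half.
rewrite (eq_bigl (fun v => s0 v == false)); first exact: half.
by move=> v; case: (s0 v).
Qed.

Lemma mixing_test t (h : config n -> R) x z :
  (forall y, 0 <= h y <= 1) -> (forall g y, stab g -> h (relabel g y) = h y) ->
  iter (t + T) P h x - iter (t + T) P h z <=
    err + (1 - (1 - beta) * (k%:R / n%:R)) ^+ t * (2 / (rho * T%:R)).
Proof.
move=> h01 hact; rewrite !iterD.
have rT : 0 <= (rho * T%:R)^-1.
  rewrite invr_ge0 mulr_ge0 // /rho mulr_ge0 // ?divr_ge0 //; exact: ltW.
pose w v := (rho * T%:R)^-1 * blk_wt R s0 (s0 v).
have w0 v : 0 <= w v by rewrite mulr_ge0 // blk_wt_ge0.
have := @iter_rss_contract R n beta beta01 k t w (iter T P h) err kn w0.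
have hw x' z' : iter T P h x' - iter T P h z' <= err + wdist w x' z'.
  apply: (le_trans (profile_smoothing x' z' h01 hact)); rewrite lerD2l.
  rewrite /wdist; under eq_bigr do rewrite -mulrA.
  rewrite -mulr_sumr; apply: ler_wpM2l => //; exact: profile_dist_wdist.
move=> /(_ hw x z)/le_trans; apply; rewrite lerD2l.
apply: ler_wpM2l.
  exact: exprn_ge0 (contraction_ge0 beta01 kn).
rewrite -mulr_sumr mulrC; apply: ler_wpM2r => //; exact: sum_blk_wt_le2.
Qed.

(** The optimal test set, where the law of the chain exceeds the Gibbs measure,
    is invariant under the permutations fixing the initial configuration. *)
Lemma mixing_tv t :
  tv_dist (kpow (rss_kernel beta k) (t + T) s0) (@gibbs R n beta) <=
    err + (1 - (1 - beta) * (k%:R / n%:R)) ^+ t * (2 / (rho * T%:R)).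
Proof.
set B := (X in _ <= X).
set mu := kpow _ _ _.
pose h y : R := (gibbs beta y <= mu y)%R%:R.
have muE y : mu y = iter (t + T) P (fun z => (z == y)%:R) s0.
  rewrite -kpow_sum (bigD1 y) //= eqxx mulr1 big1 ?addr0 // => z /negPf ->.
  by rewrite mulr0.
have mu_act g y : stab g -> mu (relabel g y) = mu y.
  move=> hg; rewrite !muE -{1}(eqP hg) -iter_rssE_relabel; congr (iter _ P _ s0).
  have actI : injective (relabel g).
    by move=> y1 y2 /ffunP e; apply/ffunP => v; have := e ((g^-1)%g v); rewrite !ffunE permKV.
  by apply: funext => z; rewrite (inj_eq actI).
have h_act g y : stab g -> h (relabel g y) = h y.
  by move=> hg; rewrite /h mu_act // gibbs_relabel.
have h01 y : 0 <= h y <= 1 by rewrite /h; case: (gibbs beta y <= mu y); rewrite /= ler01 lexx.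
have mu1 : \sum_y mu y = 1.
  under eq_bigr do rewrite -[mu _]mulr1.
  by rewrite kpow_sum iter_rssE_cst.
have -> : tv_dist mu (gibbs beta) = \sum_y mu y * h y - \sum_y gibbs beta y * h y.
  rewrite /tv_dist.
  have e1 : \sum_y (mu y - gibbs beta y) = 0 by rewrite sumrB mu1 gibbs_sum1 subrr.
  have e2 : \sum_y `|mu y - gibbs beta y| =
      \sum_y (2 * (mu y * h y - gibbs beta y * h y) - (mu y - gibbs beta y)).
    apply: eq_bigr => y _; rewrite /h; case: leP => hy.
      by rewrite (_ : true%:R = 1 :> R) // ger0_norm ?subr_ge0 //; ring.
    by rewrite (_ : false%:R = 0 :> R) // ltr0_norm ?subr_lt0 //; ring.
  by rewrite e2 sumrB e1 subr0 -mulr_sumr -sumrB mulKf // pnatr_eq0.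
rewrite kpow_sum -(iter_rss_stationary beta (t + T) h kn).
have -> : iter (t + T) P h s0 = \sum_(z : config n) gibbs beta z * iter (t + T) P h s0.
  by rewrite -mulr_suml gibbs_sum1 mul1r.
rewrite -sumrB -[X in _ <= X]mul1r -(@gibbs_sum1 R n beta) mulr_suml.
apply: ler_sum => z _; rewrite -mulrBr; apply: ler_wpM2l; first exact: gibbs_ge0.
exact: mixing_test.
Qed.

End Mixing.
End UpperBound.

(** * Moments of the total spin and the lower bound *)

Section LowerBound.
Variables (R : realType) (n : nat) (beta : R).
Hypothesis beta01 : 0 <= beta <= 1.
Implicit Types (x y z : config n) (u v : 'I_n) (vs : seq 'I_n).

Let beta0 : 0 <= beta. Proof. by case/andP: beta01. Qed.

Local Notation N := (@spinsum R n).
Local Notation bias y v := (tanh (beta * (local_field R y v / n%:R))).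

Lemma update_prob_bias y v c : update_prob beta y v c = (1 + spin R c * bias y v) / 2.
Proof. by rewrite /update_prob /p_plus /spin; case: c; field. Qed.

Lemma spinsum_scan_close (N0 : R) m vs v y c :
  `|N y - N0| + 2 * (size (v :: vs))%:R <= 2 * m%:R ->
  `|N (set_spin y v c) - N0| + 2 * (size vs)%:R <= 2 * m%:R.
Proof.
rewrite spinsum_set (spinsum_local_field R y v) [size (v :: vs)]/= -[(size vs).+1%:R]natr1.
have : `|spin R c + local_field R y v - N0| <= `|spin R (y v) + local_field R y v - N0| + 2.
  rewrite (_ : spin R c + local_field R y v - N0 =
    (spin R (y v) + local_field R y v - N0) + (spin R c - spin R (y v))); last by ring.
  apply: (le_trans (ler_normD _ _)); rewrite lerD2l.
  by apply: (le_trans (ler_normB _ _)); rewrite !spin_norm.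
lra.
Qed.

(** The old spins at the visited sites are still those of the initial
    configuration when they are erased, since the sites are distinct. *)
Lemma scan_spinsum_ge (N0 lo : R) m :
  (forall y v, `|N y - N0| <= 2 * m%:R -> lo <= bias y v) ->
  forall vs y, uniq vs -> `|N y - N0| + 2 * (size vs)%:R <= 2 * m%:R ->
  N y + \sum_(v <- vs) (lo - spin R (y v)) <= scanE beta vs N y.
Proof.
move=> hlo; elim=> [|v vs IH] y; first by rewrite big_nil addr0.
move=> uvvs hy; move: (uvvs); rewrite cons_uniq => /andP[vvs uvs].
have hl : lo <= bias y v.
  by apply: hlo; move: hy; have := ler0n R (size (v :: vs)); lra.
have tl c : N (set_spin y v c) + \sum_(w <- vs) (lo - spin R (y w)) <=
    scanE beta vs N (set_spin y v c).
  apply: le_trans (IH _ uvs (spinsum_scan_close c hy)).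
  rewrite lerD2l le_eqVlt; apply/orP; left; apply/eqP.
  rewrite big_seq [RHS]big_seq; apply: eq_bigr => w wvs; rewrite ffunE.
  by case: (eqVneq w v) => // wv; rewrite -wv wvs in vvs.
have pt := ler_wpM2l (update_prob_ge0 beta0 y v true) (tl true).
have pf := ler_wpM2l (update_prob_ge0 beta0 y v false) (tl false).
rewrite [scanE _ (v :: vs) _ _]/=; apply: le_trans (lerD pt pf).
rewrite big_cons (spinsum_local_field R y v) !spinsum_set !update_prob_bias /spin /=.
move: hl; move: (bias y v) (local_field R y v) (\sum_(w <- vs) _) => b o S; lra.
Qed.

(** The new bits have conditional means bounded by [b], so their sum has second
    moment at most [size vs + size vs ^ 2 * b] and a mean at most [size vs * b]. *)
Lemma scan_spinsum_sqr_le (N0 b : R) m :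
  (forall y v, `|N y - N0| <= 2 * m%:R -> `|bias y v| <= b) ->
  forall vs y, uniq vs -> `|N y - N0| + 2 * (size vs)%:R <= 2 * m%:R ->
  scanE beta vs (fun z => N z ^+ 2) y <=
    (N y - \sum_(v <- vs) spin R (y v)) ^+ 2
    + 2 * `|N y - \sum_(v <- vs) spin R (y v)| * (size vs)%:R * b
    + (size vs)%:R + (size vs)%:R ^+ 2 * b.
Proof.
move=> hb; elim=> [|v vs IH] y.
  by move=> _ _; rewrite big_nil /= subr0 expr0n /= !(mulr0, mul0r, addr0).
move=> uvvs hy; move: (uvvs); rewrite cons_uniq => /andP[vvs uvs].
have hl : `|bias y v| <= b.
  by apply: hb; move: hy; have := ler0n R (size (v :: vs)); lra.
have b0 : 0 <= b := le_trans (normr_ge0 _) hl.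
set S := \sum_(w <- vs) spin R (y w).
have tl c : scanE beta vs (fun z => N z ^+ 2) (set_spin y v c) <=
    (spin R c + local_field R y v - S) ^+ 2
    + 2 * (`|local_field R y v - S| + 1) * (size vs)%:R * b
    + (size vs)%:R + (size vs)%:R ^+ 2 * b.
  apply: (le_trans (IH _ uvs (spinsum_scan_close c hy))).
  have -> : \sum_(w <- vs) spin R (set_spin y v c w) = S.
    rewrite big_seq [RHS]big_seq; apply: eq_bigr => w wvs; rewrite ffunE.
    by case: (eqVneq w v) => // wv; rewrite -wv wvs in vvs.
  rewrite spinsum_set !lerD2r lerD2l; apply: ler_wpM2r => //; apply: ler_wpM2r => //.
  rewrite ler_pM2l // -addrA addrC; apply: (le_trans (ler_normD _ _)).
  by rewrite spin_norm.
have pt := ler_wpM2l (update_prob_ge0 beta0 y v true) (tl true).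
have pf := ler_wpM2l (update_prob_ge0 beta0 y v false) (tl false).
rewrite [scanE _ (v :: vs) _ _]/=; apply: (le_trans (lerD pt pf)).
rewrite big_cons -/S (spinsum_local_field R y v) !update_prob_bias [size (v :: vs)]/= -[(size vs).+1%:R]natr1.
rewrite (_ : spin R (y v) + local_field R y v - (spin R (y v) + S) = local_field R y v - S); last by ring.
rewrite -[spin R true + _ - S]addrA -[spin R false + _ - S]addrA /spin /=.
move: (local_field R y v - S) => q.
have qb : q * bias y v <= `|q| * b.
  by apply: (le_trans (ler_norm _)); rewrite normrM; apply: ler_wpM2l.
move: hl qb (size vs)%:R (ler0n R (size vs)); move: (bias y v) (normr_ge0 q) => c.
move: `|q| => aq q0 hc qb s s0.
lra.
Qed.

Variable k : nat.
Hypothesis k_gt0 : (0 < k)%N.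
Hypothesis kn : (k <= n)%N.

Let kap : R := 1 - (1 - beta) * (k%:R / n%:R).

Lemma local_field_close (N0 : R) y v : `|N y - N0| <= 2 * k%:R ->
  `|local_field R y v - N0| <= 3 * k%:R.
Proof.
rewrite (spinsum_local_field R y v) => h.
have -> : local_field R y v - N0 = (spin R (y v) + local_field R y v - N0) - spin R (y v) by ring.
apply: (le_trans (ler_normB _ _)); rewrite spin_norm.
have : 1 <= k%:R :> R by rewrite ler1n.
lra.
Qed.

Lemma bias_le (N0 : R) y v : `|N y - N0| <= 2 * k%:R ->
  `|bias y v| <= beta * ((`|N0| + 3 * k%:R) / n%:R).
Proof.
move=> /(local_field_close v) h; apply: (le_trans (tanh_norm_le _)).
rewrite normrM (ger0_norm beta0); apply: ler_wpM2l => //.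
rewrite normrM [`|_^-1|]ger0_norm ?invr_ge0 //; apply: ler_wpM2r; first by rewrite invr_ge0.
rewrite (_ : local_field R y v = N0 + (local_field R y v - N0)); last by ring.
by apply: (le_trans (ler_normD _ _)); rewrite lerD2l.
Qed.

Lemma bias_ge (N0 : R) y v : `|N y - N0| <= 2 * k%:R ->
  beta * N0 / n%:R - 3 * k%:R / n%:R - 2 * (N0 ^+ 2 + 9 * k%:R ^+ 2) / n%:R ^+ 2 <= bias y v.
Proof.
move=> /(local_field_close v); rewrite ler_norml => /andP[h1 h2].
apply: le_trans (tanh_ge_quad _).
have n0 : 0 < n%:R :> R by rewrite ltr0n (leq_ltn_trans _ (ltn_ord v)).
have ni : 0 < (n%:R)^-1 :> R by rewrite invr_gt0.
have /andP[b0 b1] := beta01.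
set o := local_field R y v in h1 h2 *.
have k0 : 0 <= k%:R :> R by [].
have e1 : (beta * (N0 - 3 * k%:R)) / n%:R <= beta * (o / n%:R).
  by rewrite mulrA ler_pM2r //; apply: ler_wpM2l => //; lra.
have e2 : (beta * (o / n%:R)) ^+ 2 <= 2 * (N0 ^+ 2 + 9 * k%:R ^+ 2) / n%:R ^+ 2.
  rewrite (_ : (beta * (o / n%:R)) ^+ 2 = beta ^+ 2 * o ^+ 2 / n%:R ^+ 2); last first.
    by field; rewrite gt_eqF.
  rewrite ler_pM2r ?invr_gt0 ?exprn_gt0 //.
  have bb : beta ^+ 2 <= 1 by rewrite expr_le1.
  have o2 : o ^+ 2 <= 2 * (N0 ^+ 2 + 9 * k%:R ^+ 2) by have := sqr_ge0 (N0 - (o - N0)); nra.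
  apply: le_trans o2; rewrite -[X in _ <= X]mul1r; apply: ler_wpM2r => //; exact: sqr_ge0.
have e3 : beta * N0 / n%:R - 3 * k%:R / n%:R <= beta * (N0 - 3 * k%:R) / n%:R.
  by rewrite -mulrBl ler_pM2r //; nra.
lra.
Qed.

Lemma rss_spinsum_ge x :
  kap * N x - 2 * k%:R / n%:R ^+ 2 * N x ^+ 2 - 21 * k%:R ^+ 2 / n%:R <= rssE beta k N x.
Proof.
have n0 : 0 < n%:R :> R by rewrite ltr0n (leq_trans k_gt0 kn).
set lo := beta * N x / n%:R - 3 * k%:R / n%:R - 2 * (N x ^+ 2 + 9 * k%:R ^+ 2) / n%:R ^+ 2.
apply: (@le_trans _ _ (uavg k (fun vs => N x + (k%:R * lo + - 1 * \sum_(v <- vs) spin R (x v))))); last first.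
  apply: uavg_le => vs uv sv.
  have := @scan_spinsum_ge (N x) lo k (fun y v => @bias_ge (N x) y v) vs x uv.
  rewrite subrr normr0 add0r sv lexx => /(_ isT); apply: le_trans.
  rewrite lerD2l sumrB big_const_seq count_predT iter_addr_0 sv.
  by rewrite -[lo *+ k]mulr_natl mulN1r.
rewrite !uavgD !uavg_cst // uavgZ uavg_sum_seq // -/(N x) /kap /lo.
have kk : k%:R <= n%:R :> R by rewrite ler_nat.
have k0 : 0 <= k%:R :> R by [].
have h : 18 * k%:R ^+ 3 / n%:R ^+ 2 <= 18 * k%:R ^+ 2 / n%:R :> R.
  rewrite (_ : 18 * k%:R ^+ 3 / n%:R ^+ 2 = 18 * k%:R ^+ 2 / n%:R * (k%:R / n%:R)); last first.
    by field; rewrite gt_eqF.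
  rewrite -[X in _ <= X]mulr1; apply: ler_wpM2l.
    by rewrite divr_ge0 ?mulr_ge0 ?exprn_ge0 // ltW.
  by rewrite ler_pdivrMr // mul1r.
suff -> : N x + (k%:R * (beta * N x / n%:R - 3 * k%:R / n%:R
    - 2 * (N x ^+ 2 + 9 * k%:R ^+ 2) / n%:R ^+ 2) + -1 * (k%:R / n%:R * N x)) =
  (1 - (1 - beta) * (k%:R / n%:R)) * N x - 2 * k%:R / n%:R ^+ 2 * N x ^+ 2
    - 3 * k%:R ^+ 2 / n%:R - 18 * k%:R ^+ 3 / n%:R ^+ 2.
  lra.
by field; rewrite gt_eqF.
Qed.

Hypothesis k_small : k%:R ^+ 2 <= n%:R :> R.

(** The terms in [k ^ 2 |N| / n] are split by the arithmetic-geometric inequality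
    into [k] and [k ^ 3 N ^ 2 / n ^ 2]; the latter, summed over
    [n log n / k] steps, is of order [k ^ 2 log n / n] relative to [N ^ 2]. *)
Lemma rss_spinsum_sqr_le x : rssE beta k (fun z => N z ^+ 2) x <=
  (1 - 2 * ((1 - beta) * (k%:R / n%:R)) + 6 * k%:R ^+ 3 / n%:R ^+ 2) * N x ^+ 2 + 16 * k%:R.
Proof.
have n0 : 0 < n%:R :> R by rewrite ltr0n (leq_trans k_gt0 kn).
have k1 : 1 <= k%:R :> R by rewrite ler1n.
have kk : k%:R <= n%:R :> R by rewrite ler_nat.
have /andP[b0 b1] := beta01.
set b := beta * ((`|N x| + 3 * k%:R) / n%:R).
have bnn : 0 <= b by rewrite mulr_ge0 ?divr_ge0 ?addr_ge0 ?mulr_ge0.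
apply: (@le_trans _ _ (uavg k (fun vs =>
   (N x ^+ 2 + (2 * (`|N x| + k%:R) * k%:R * b + k%:R + k%:R ^+ 2 * b))
   + (- (2 * N x) * (\sum_(v <- vs) spin R (x v)) + (\sum_(v <- vs) spin R (x v)) ^+ 2)))).
  apply: uavg_le => vs uv sv.
  have := @scan_spinsum_sqr_le (N x) b k (fun y v => @bias_le (N x) y v) vs x uv.
  rewrite subrr normr0 add0r sv lexx => /(_ isT)/le_trans; apply.
  set S := \sum_(v <- vs) _.
  have Sk : `|S| <= k%:R.
    apply: (le_trans (ler_norm_sum _ _ _)); under eq_bigr do rewrite spin_norm.
    by rewrite big_const_seq count_predT iter_addr_0 sv.
  have h : `|N x - S| <= `|N x| + k%:R by apply: (le_trans (ler_normB _ _)); rewrite lerD2l.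
  have : 2 * `|N x - S| * k%:R * b <= 2 * (`|N x| + k%:R) * k%:R * b.
    by apply: ler_wpM2r => //; apply: ler_wpM2r => //; rewrite ler_pM2l.
  lra.
rewrite !uavgD !uavg_cst // uavgZ uavg_sum_seq // -/(N x).
have hR := @uavg_sqr_sum_seq R n k (fun v => spin R (x v)) kn.
have {}hR := hR (fun v => eq_ind_r (fun a => a <= 1) (lexx 1) (spin_sqr R (x v))).
rewrite -/(N x) in hR.
set t := k%:R / n%:R in hR *.
have t0 : 0 <= t by rewrite divr_ge0.
have t1 : t <= 1 by rewrite ler_pdivrMr // mul1r.
have kt : k%:R * t <= 1 by rewrite mulrA -expr2 ler_pdivrMr // mul1r.
have bE : b * k%:R = beta * t * (`|N x| + 3 * k%:R) by rewrite /b /t; ring.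
have a2 : `|N x| ^+ 2 = N x ^+ 2 by rewrite real_normK ?num_real.
have e3 : 6 * k%:R ^+ 3 / n%:R ^+ 2 = 6 * k%:R * t ^+ 2 by rewrite /t; field; rewrite gt_eqF.
rewrite e3.
apply: (le_trans (lerD (lexx _) (lerD (lexx _) hR))).
set K := k%:R in kt bE k1 *; set a := `|N x| in bE a2 *; set m := N x in a2 *.
have a0 : 0 <= a by exact: normr_ge0.
have b1' : K * b * (2 * a + 3 * K) <= 2 * beta * t * m ^+ 2 + t * (9 * a * K + 9 * K ^+ 2).
  rewrite [K * b]mulrC bE -a2.
  have h : t * beta * (9 * a * K + 9 * K ^+ 2) <= t * (9 * a * K + 9 * K ^+ 2).
    apply: ler_wpM2r; last by rewrite -[X in _ <= X]mulr1; apply: ler_wpM2l.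
    by rewrite addr_ge0 ?mulr_ge0 ?exprn_ge0 //; lra.
  lra.
have h1 : 2 * K * (t * a) <= K + K * t ^+ 2 * m ^+ 2.
  by have := mulr_ge0 (_ : 0 <= K) (sqr_ge0 (1 - t * a)); rewrite -a2 => /(_ ltac:(lra)); lra.
have h2 : K * (K * t) <= K * 1 by apply: ler_wpM2l => //; lra.
have h3 : t ^+ 2 * m ^+ 2 <= K * (t ^+ 2 * m ^+ 2).
  by rewrite -[X in X <= _]mul1r; apply: ler_wpM2r => //; rewrite mulr_ge0 ?sqr_ge0.
have h4 : 0 <= K * (t ^+ 2 * m ^+ 2) := mulr_ge0 (le_trans ler01 k1) (mulr_ge0 (sqr_ge0 t) (sqr_ge0 m)).
lra.
Qed.

Hypothesis beta1 : beta < 1.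
Hypothesis k_small12 : 12 * k%:R ^+ 2 <= (1 - beta) * n%:R.

Local Notation P := (rssE beta k).
Let u : R := (1 - beta) * (k%:R / n%:R).
Let r : R := 1 - 2 * u + 6 * k%:R ^+ 3 / n%:R ^+ 2.
Let C3 : R := 11 / (1 - beta).
Let B : R := (2 * C3 + 21 * k%:R) / (1 - beta).

(** With [12 k ^ 2 <= (1 - beta) n] the cubic error in [r] is at most [u / 2]. *)
Lemma rates : [/\ 0 < u <= 1 / 12, 0 <= r, r <= 1 - 3 / 2 * u & r <= (1 - u) * (1 - u / 2)].
Proof.
have n0 : 0 < n%:R :> R by rewrite ltr0n (leq_trans k_gt0 kn).
have k1 : 1 <= k%:R :> R by rewrite ler1n.
have hb := beta1; have b0 := beta0.
have u0 : 0 < u by rewrite mulr_gt0 ?divr_gt0 ?subr_gt0 //; lra.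
have nk : 12 * k%:R ^+ 2 / n%:R <= 1 - beta by rewrite ler_pdivrMr.
have e : 6 * k%:R ^+ 3 / n%:R ^+ 2 = 1 / 2 * (12 * k%:R ^+ 2 / n%:R) * (k%:R / n%:R) :> R.
  by field; rewrite gt_eqF.
have t0 : 0 < k%:R / n%:R :> R by rewrite divr_gt0 //; lra.
have e1 : 0 <= 6 * k%:R ^+ 3 / n%:R ^+ 2 :> R.
  by rewrite divr_ge0 ?mulr_ge0 ?exprn_ge0 // ltW.
have e2 : 6 * k%:R ^+ 3 / n%:R ^+ 2 <= u / 2.
  rewrite e /u; have := ler_wpM2r (ltW t0) nk; lra.
have u1 : u <= 1 / 12.
  have h : 12 * (k%:R / n%:R) <= 12 * k%:R ^+ 2 / n%:R :> R.
    by rewrite mulrA ler_pM2r ?invr_gt0 //; nra.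
  rewrite /u; have : k%:R / n%:R <= (1 - beta) / 12 by lra.
  by move: (_ / n%:R) t0 => t t0 ht; nra.
split; first by rewrite u0.
- rewrite /r; lra.
- rewrite /r; lra.
by rewrite /r; have := sqr_ge0 u; lra.
Qed.

Lemma C3_gt0 : 0 < C3.
Proof. by rewrite /C3 divr_gt0 // subr_gt0. Qed.

Lemma C3_absorbs : 16 * k%:R <= C3 * n%:R * (1 - r).
Proof.
have [/andP[u0 _] _ r1 _] := rates.
have n0 : 0 < n%:R :> R by rewrite ltr0n (leq_trans k_gt0 kn).
have k0 : 0 <= k%:R :> R by [].
apply: (@le_trans _ _ (C3 * n%:R * (3 / 2 * u))); last first.
  apply: ler_wpM2l; first by rewrite mulr_ge0 // ltW // C3_gt0.
  by move: r1; lra.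
have -> : C3 * n%:R * (3 / 2 * u) = 33 / 2 * k%:R.
  by rewrite /C3 /u; field; rewrite !gt_eqF ?subr_gt0.
lra.
Qed.

Lemma iter_spinsum_sqr_le t x :
  iter t P (fun z => N z ^+ 2) x <= r ^+ t * N x ^+ 2 + C3 * n%:R.
Proof.
have [_ r0 _ _] := rates; have c0 := C3_gt0; have c1 := C3_absorbs.
have cn : 0 <= C3 * n%:R by rewrite mulr_ge0 // ltW.
elim: t x => [|t IH] x; first by rewrite expr0 mul1r lerDl.
rewrite iterSr; apply: (@le_trans _ _ (iter t P (fun z => 16 * k%:R + r * N z ^+ 2) x)).
  by apply: iter_rssE_le => // y; rewrite addrC; exact: rss_spinsum_sqr_le.
rewrite iter_rssED iter_rssE_cst // iter_rssEZ exprS.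
have := ler_wpM2l r0 (IH x); lra.
Qed.

(** By stationarity, the drift inequality for one step is an inequality for the
    second moment itself. *)
Lemma gibbs_spinsum_sqr_le : \sum_x gibbs beta x * N x ^+ 2 <= C3 * n%:R.
Proof.
have [/andP[u0 _] _ r1 _] := rates; have c1 := C3_absorbs.
set E := \sum_x _.
have h : E <= r * E + 16 * k%:R.
  rewrite {1}/E -(rss_stationary beta _ kn).
  apply: (@le_trans _ _ (\sum_x gibbs beta x * (r * N x ^+ 2 + 16 * k%:R))).
    apply: ler_sum => x _; apply: ler_wpM2l; first exact: gibbs_ge0.
    exact: rss_spinsum_sqr_le.
  under eq_bigr do rewrite mulrDr mulrCA.
  by rewrite big_split /= -mulr_sumr -mulr_suml gibbs_sum1 mul1r.
have r1' : 0 < 1 - r by lra.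
rewrite -(ler_pM2r r1'); apply: le_trans c1; lra.
Qed.

(** The quadratic loss decays like the second moment, hence faster by the factor
    [1 - u / 2] per step than the mean, and costs only the proportion
    [8 N x / ((1 - beta) n)] of it. *)
Lemma iter_spinsum_ge t x :
  kap ^+ t * N x - 8 * N x ^+ 2 / ((1 - beta) * n%:R) * kap ^+ t - B <= iter t P N x.
Proof.
have [/andP[u0 u1] r0 _ r2] := rates.
have n0 : 0 < n%:R :> R by rewrite ltr0n (leq_trans k_gt0 kn).
have hb := beta1.
have b0 : 0 < 1 - beta by lra.
have kR0 : 0 < k%:R :> R by rewrite ltr0n.
have kapE : kap = 1 - u by [].
have kap0 : 0 <= kap by rewrite kapE; lra.
have th0 : 0 <= 1 - u / 2 by lra.
set A := 8 * N x ^+ 2 / ((1 - beta) * n%:R).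
have A0 : 0 <= A.
  by apply: divr_ge0; apply: mulr_ge0; rewrite ?sqr_ge0 //; exact: ltW.
have B0 : 0 <= B.
  have c3 := C3_gt0; rewrite /B; apply: divr_ge0; last exact: ltW.
  by apply: addr_ge0; apply: mulr_ge0 => //; exact: ltW.
(* relative to kap ^ t, the increments of the loss decay like (1 - u / 2) ^ t *)
suff main : kap ^+ t * N x - A * kap ^+ t * (1 - (1 - u / 2) ^+ t) - B <= iter t P N x.
  apply: le_trans main; rewrite lerD2r lerD2l lerN2 -[X in _ <= X]mulr1.
  apply: ler_wpM2l; first by rewrite mulr_ge0 // exprn_ge0.
  by rewrite gerBl exprn_ge0.
elim: t => [|t IH]; first by rewrite !expr0 subrr mulr0 mul1r subr0 gerBl.
have step : kap * iter t P N x - 2 * k%:R / n%:R ^+ 2 * (iter t P (fun z => N z ^+ 2) x)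
     - 21 * k%:R ^+ 2 / n%:R <= iter t.+1 P N x.
  set c := 2 * _ / _; set d := 21 * _ / _.
  have -> : kap * iter t P N x - c * iter t P (fun z => N z ^+ 2) x - d =
      iter t P (fun z => (kap * N z + - c * N z ^+ 2) + - d) x.
    by rewrite !iter_rssED iter_rssE_cst // !iter_rssEZ mulNr.
  by rewrite iterSr; apply: iter_rssE_le => // y; rewrite mulNr; exact: rss_spinsum_ge.
apply: le_trans step.
have sq := iter_spinsum_sqr_le t x.
have c0 : 0 <= 2 * k%:R / n%:R ^+ 2 :> R by rewrite divr_ge0 ?mulr_ge0 ?exprn_ge0 // ltW.
have i1 := ler_wpM2l c0 sq; have i2 := ler_wpM2l kap0 IH.
have rt : r ^+ t <= kap ^+ t * (1 - u / 2) ^+ t.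
  by rewrite -exprMn; apply: lerXn2r; rewrite ?nnegrE ?mulr_ge0 // kapE.
have i3 : 2 * k%:R / n%:R ^+ 2 * (r ^+ t * N x ^+ 2) <=
    A * kap * (u / 2) * (kap ^+ t * (1 - u / 2) ^+ t).
  apply: (@le_trans _ _ (2 * k%:R / n%:R ^+ 2 * N x ^+ 2 * (kap ^+ t * (1 - u / 2) ^+ t))).
    by rewrite [r ^+ t * _]mulrC mulrA; apply: ler_wpM2l => //; rewrite mulr_ge0 ?sqr_ge0.
  apply: ler_wpM2r; first by rewrite mulr_ge0 // exprn_ge0.
  have -> : 2 * k%:R / n%:R ^+ 2 * N x ^+ 2 = A * (1 / 2) * (u / 2).
    by rewrite /A /u; field; rewrite !gt_eqF.
  by apply: ler_wpM2r; [lra|apply: ler_wpM2l => //; rewrite kapE; lra].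
have i4 : 2 * k%:R / n%:R ^+ 2 * (C3 * n%:R) + 21 * k%:R ^+ 2 / n%:R = u * B.
  by rewrite /B /u; field; rewrite !gt_eqF.
have arith (K' U p q M A' B' I X Y1 Y2 Y3 : R) : K' = 1 - U -> Y2 <= X + Y1 ->
    K' * (p * M - A' * p * (1 - q) - B') <= K' * I -> X <= A' * K' * (U / 2) * (p * q) ->
    Y1 + Y3 = U * B' ->
    K' * p * M - A' * (K' * p) * (1 - (1 - U / 2) * q) - B' <= K' * I - Y2 - Y3.
  by move=> -> h1 h2 h3 h4; lra.
rewrite mulrDr in i1; rewrite [kap ^+ _]exprS [(1 - u / 2) ^+ _]exprS.
exact: (arith _ _ _ _ _ _ _ _ _ _ _ _ kapE i1 i2 i3 i4).
Qed.

(** Chebyshev's inequality around [kap ^ t * N x], applied to the event that the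
    total spin is at least half of this value; under the Gibbs measure the
    event is unlikely because the total spin has second moment of order [n]. *)
Lemma lower_tv t x (eta : R) : 0 < N x -> r ^+ t <= (1 + eta) * kap ^+ (2 * t) ->
  1 - (4 * eta + 64 * (N x / n%:R) / (1 - beta)
       + 8 * C3 * n%:R / (kap ^+ t * N x) ^+ 2 + 8 * B / (kap ^+ t * N x)) <=
  tv_dist (kpow (rss_kernel beta k) t x) (gibbs beta).
Proof.
move=> N0 hr.
have [/andP[u0 u1] r0 _ r2] := rates.
have n0 : 0 < n%:R :> R by rewrite ltr0n (leq_trans k_gt0 kn).
have hb := beta1.
have b0 : 0 < 1 - beta by lra.
have kap0 : 0 < kap by rewrite (_ : kap = 1 - u) //; lra.
set mu := kap ^+ t * N x.
have mu0 : 0 < mu by rewrite mulr_gt0 // exprn_gt0.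
pose h y : R := (mu / 2 <= N y)%R%:R.
have hT y : mu / 2 <= N y -> h y = 1 by rewrite /h => ->.
have hF y : N y < mu / 2 -> h y = 0 by rewrite /h ltNge => /negPf ->.
pose nu := kpow (rss_kernel beta k) t x.
have nuE F : \sum_y nu y * F y = iter t P F x by exact: kpow_sum.
have nu1 : \sum_y nu y = 1.
  by under eq_bigr do rewrite -[nu _]mulr1; rewrite nuE iter_rssE_cst.
have test : \sum_y nu y * h y - \sum_y gibbs beta y * h y <= tv_dist nu (gibbs beta).
  rewrite /tv_dist -(ler_pM2l (ltr0n R 2)) mulrA divff ?pnatr_eq0 // mul1r.
  rewrite -sumrB mulr_sumr.
  have -> : \sum_y 2 * (nu y * h y - gibbs beta y * h y) =
      \sum_y (nu y - gibbs beta y) * (2 * h y - 1).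
    under [RHS]eq_bigr do rewrite mulrBr mulr1.
    rewrite sumrB sumrB nu1 gibbs_sum1 subrr subr0.
    by apply: eq_bigr => y _; ring.
  apply: ler_sum => y _; apply: (le_trans (ler_norm _)).
  rewrite normrM -[X in _ <= X]mulr1; apply: ler_wpM2l => //.
  have [/hT ->|/hF ->] := leP (mu / 2) (N y).
    by rewrite mulr1 (_ : 2 - 1 = 1 :> R) ?normr1 //; ring.
  by rewrite mulr0 sub0r normrN normr1.
apply: le_trans test.
have up : \sum_y gibbs beta y * h y <= 4 * (C3 * n%:R) / mu ^+ 2.
  rewrite [X in _ <= X](_ : _ = 4 / mu ^+ 2 * (C3 * n%:R)); last by ring.
  apply: (@le_trans _ _ (4 / mu ^+ 2 * \sum_y gibbs beta y * N y ^+ 2)); last first.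
    by apply: ler_wpM2l gibbs_spinsum_sqr_le; rewrite divr_ge0 ?sqr_ge0.
  rewrite mulr_sumr; apply: ler_sum => y _; rewrite mulrCA; apply: ler_wpM2l; first exact: gibbs_ge0.
  have [hy|/hF ->] := leP (mu / 2) (N y); last by rewrite mulr_ge0 ?divr_ge0 ?sqr_ge0.
  by rewrite (hT _ hy) mulrAC ler_pdivlMr ?exprn_gt0 // mul1r; nra.
have down : 1 - \sum_y nu y * h y <= 4 / mu ^+ 2 *
    ((iter t P (fun z => N z ^+ 2) x - 2 * mu * iter t P N x) + mu ^+ 2).
  have -> : 1 - \sum_y nu y * h y = iter t P (fun y => 1 - h y) x.
    rewrite -nuE; under [RHS]eq_bigr do rewrite mulrBr mulr1.
    by rewrite sumrB nu1.
  have -> : (iter t P (fun z => N z ^+ 2) x - 2 * mu * iter t P N x) + mu ^+ 2 =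
      iter t P (fun z => (N z ^+ 2 + - (2 * mu) * N z) + mu ^+ 2) x.
    by rewrite !iter_rssED iter_rssE_cst // iter_rssEZ mulNr.
  rewrite -iter_rssEZ; apply: iter_rssE_le => // y.
  have -> : N y ^+ 2 + - (2 * mu) * N y + mu ^+ 2 = (mu - N y) ^+ 2 by ring.
  have [/hT ->|hy] := leP (mu / 2) (N y); first by rewrite subrr mulr_ge0 ?divr_ge0 ?sqr_ge0.
  by rewrite (hF _ hy) subr0 mulrAC ler_pdivlMr ?exprn_gt0 // mul1r; nra.
have sq := iter_spinsum_sqr_le t x.
have mn := iter_spinsum_ge t x.
have rmu : r ^+ t * N x ^+ 2 <= (1 + eta) * mu ^+ 2.
  have -> : mu ^+ 2 = kap ^+ (2 * t) * N x ^+ 2 by rewrite /mu exprMn mulnC exprM.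
  by rewrite mulrA; apply: ler_wpM2r => //; exact: sqr_ge0.
have mn2 : mu - 8 * (N x / n%:R) / (1 - beta) * mu - B <= iter t P N x.
  apply: le_trans mn; rewrite lerD2r lerD2l lerN2 le_eqVlt; apply/orP; left; apply/eqP.
  by rewrite /mu; field; rewrite !gt_eqF.
have q0 : 0 <= 4 / mu ^+ 2 by rewrite divr_ge0 ?sqr_ge0.
have m2 : 0 <= 2 * mu by lra.
have e1 := ler_wpM2l m2 mn2.
have e2 : (iter t P (fun z => N z ^+ 2) x - 2 * mu * iter t P N x) + mu ^+ 2 <=
   eta * mu ^+ 2 + 16 * (N x / n%:R) / (1 - beta) * mu ^+ 2 + C3 * n%:R + 2 * B * mu by lra.
have e3 := ler_wpM2l q0 e2.
have e4 : 4 / mu ^+ 2 * (eta * mu ^+ 2 + 16 * (N x / n%:R) / (1 - beta) * mu ^+ 2 + C3 * n%:R + 2 * B * mu) =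
   4 * eta + 64 * (N x / n%:R) / (1 - beta) + 4 * (C3 * n%:R) / mu ^+ 2 + 8 * B / mu.
  by field; rewrite !gt_eqF.
rewrite e4 in e3.
have -> : 8 * C3 * n%:R / mu ^+ 2 = 4 * (C3 * n%:R) / mu ^+ 2 + 4 * (C3 * n%:R) / mu ^+ 2 by ring.
move: down up e3; move: (4 * (C3 * n%:R) / mu ^+ 2) (8 * B / mu) (64 * _ / _) (4 / mu ^+ 2 * _).
move=> X1 X2 X3 X4; lra.
Qed.


End LowerBound.

(** * Explicit bounds at the cutoff times *)

(** The inequality [1 - u >= exp (- u / (1 - u))] replaces the expansion of the
    logarithm; the second-order loss is harmless because [u L <= 1]. *)
Lemma power_lower (R : realType) (t : nat) (u L g : R) : 0 < u <= 1 / 12 -> 0 <= g ->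
  t%:R * u <= L / 2 - g -> u * L <= 1 -> expR (- (L / 2) + g - 1) <= (1 - u) ^+ t.
Proof.
move=> /andP[u0 u12] g0 tu uL; set kap := 1 - u.
have kap0 : 0 < kap by rewrite /kap; lra.
have kge : expR (- (u + 2 * u ^+ 2)) <= kap.
  have h : kap^-1 <= expR (u / kap).
    apply: le_trans (expR_ge1Dx _); rewrite le_eqVlt; apply/orP; left; apply/eqP.
    by rewrite /kap; field; rewrite gt_eqF.
  have h' : u / kap <= u + 2 * u ^+ 2.
    have uu : 0 <= u ^+ 2 * (1 - 2 * u) by rewrite mulr_ge0 ?sqr_ge0 //; lra.
    by rewrite ler_pdivrMr // /kap; lra.
  rewrite expRN -[X in _ <= X]invrK lef_pV2 ?posrE ?expR_gt0 ?invr_gt0 //.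
  by apply: (le_trans h); rewrite ler_expR.
apply: (@le_trans _ _ (expR (- (u + 2 * u ^+ 2)) ^+ t)); last first.
  by apply: lerXn2r => //; rewrite nnegrE ?expR_ge0 // ltW.
rewrite -expRM_natl ler_expR.
have : u * (t%:R * u) <= u * (L / 2) by apply: ler_wpM2l; lra.
lra.
Qed.

(** The second moment decays at the rate [r] and the square of the mean at
    [(1 - u) ^ 2]; the ratio of the two rates is at most [exp y]. *)
Lemma power_ratio (R : realType) (t : nat) (u y q : R) : 0 < u <= 1 / 12 -> 0 <= y ->
  0 < q <= 1 / 2 -> t%:R * y <= q / 2 ->
  (1 - 2 * u + 1 / 2 * y) ^+ t <= (1 + q) * (1 - u) ^+ (2 * t).
Proof.
move=> /andP[u0 u12] y0 /andP[q0 q12] ty; set kap := 1 - u.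
have kap0 : 0 < kap by rewrite /kap; lra.
have base : 1 - 2 * u + 1 / 2 * y <= kap ^+ 2 * expR y.
  have u2 := sqr_ge0 u.
  have hk2 : 1 / 2 <= kap ^+ 2 by rewrite /kap; lra.
  have h1 : kap ^+ 2 * (1 + y) <= kap ^+ 2 * expR y.
    by apply: ler_wpM2l; [lra|exact: expR_ge1Dx].
  have h2 : 1 / 2 * y <= kap ^+ 2 * y by apply: ler_wpM2r.
  have e : kap ^+ 2 = 1 - 2 * u + u ^+ 2 by rewrite /kap; ring.
  rewrite mulrDr mulr1 in h1; lra.
apply: (@le_trans _ _ ((kap ^+ 2 * expR y) ^+ t)).
  by apply: lerXn2r => //; rewrite nnegrE; [lra|rewrite mulr_ge0 ?expR_ge0 ?sqr_ge0].
rewrite exprMn -exprM mulrC; apply: ler_wpM2r; first exact: exprn_ge0 (ltW kap0).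
rewrite -expRM_natl; apply: (@le_trans _ _ (expR (q / 2))); first by rewrite ler_expR.
have h : 0 < 1 - q / 2 by lra.
apply: (le_trans (expR_le_inv _)); first lra.
by rewrite -[_^-1]mul1r ler_pdivrMr //; nra.
Qed.

Lemma lower_error (R : realType) (c C3 q s N n k mu E : R) :
  0 < c -> 0 < C3 -> 0 < q -> q <= 1 / 2 -> 0 < s -> s ^+ 2 = n -> 1 <= k -> k <= s ->
  0 < E -> 0 < mu -> N / n <= 2 * q -> s / mu <= E * q ->
  4 * q + 64 * (N / n) / c + 8 * C3 * n / mu ^+ 2 + 8 * ((2 * C3 + 21 * k) / c) / mu <=
  q * (4 + 128 / c + 8 * C3 * E ^+ 2 + 8 * ((2 * C3 + 21) / c) * E).
Proof.
move=> c0 C30 q0 q12 s0 <- k1 ks E0 mu0 hN hX.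
set X := s / mu in hX; have X0 : 0 < X by rewrite divr_gt0.
have ci : 0 < c^-1 by rewrite invr_gt0.
have a1 : 64 * (N / s ^+ 2) / c <= 64 * (2 * q) / c by rewrite ler_pM2r // ler_pM2l.
have a2 : 8 * C3 * s ^+ 2 / mu ^+ 2 <= 8 * C3 * (E ^+ 2 * q).
  have -> : 8 * C3 * s ^+ 2 / mu ^+ 2 = 8 * C3 * X ^+ 2 by rewrite /X; field; rewrite gt_eqF.
  rewrite ler_pM2l ?mulr_gt0 //; apply: (@le_trans _ _ ((E * q) ^+ 2)).
    by apply: lerXn2r => //; rewrite nnegrE ltW // mulr_gt0.
  rewrite exprMn ler_pM2l ?exprn_gt0 // expr2 -[X in _ <= X]mulr1 ler_pM2l //; lra.
have a3 : 8 * ((2 * C3 + 21 * k) / c) / mu <= 8 * ((2 * C3 + 21) / c) * (E * q).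
  have -> : 8 * ((2 * C3 + 21 * k) / c) / mu = 8 / c * (((2 * C3 + 21 * k) / s) * X).
    by rewrite /X; field; rewrite !gt_eqF.
  have -> : 8 * ((2 * C3 + 21) / c) * (E * q) = 8 / c * ((2 * C3 + 21) * (E * q)) by ring.
  have y0 : 0 <= (2 * C3 + 21 * k) / s by rewrite divr_ge0 ?(ltW s0) //; lra.
  rewrite ler_pM2l ?divr_gt0 //; apply: ler_pM => //; first exact: ltW.
  rewrite ler_pdivrMr //.
  have : C3 * 1 <= C3 * s by rewrite ler_pM2l //; lra.
  lra.
have e1 : 64 * (2 * q) / c = q * (128 / c) by ring.
lra.
Qed.

Section FiniteBounds.
Variables (R : realType) (n : nat) (beta : R) (k : nat).
Hypothesis beta01 : 0 < beta < 1.
Hypothesis k_gt0 : (0 < k)%N.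
Hypothesis kn : (k <= n)%N.

Let c : R := 1 - beta.
Let w : R := n%:R / k%:R.
Let tn : R := n%:R * ln n%:R / (2 * k%:R * (1 - beta)).

Let beta01' : 0 <= beta <= 1. Proof. by case/andP: beta01 => /ltW -> /ltW ->. Qed.
Let c_gt0 : 0 < c. Proof. by rewrite subr_gt0; case/andP: beta01. Qed.
Let n_gt0 : (0 < n)%N. Proof. exact: leq_trans k_gt0 kn. Qed.
Let nR : 0 < n%:R :> R. Proof. by rewrite ltr0n. Qed.
Let kR : 0 < k%:R :> R. Proof. by rewrite ltr0n. Qed.

Lemma rss_dist_ge0 t : 0 <= rss_dist n beta k t.
Proof. exact: bigmax_ge_id. Qed.

Lemma rss_dist_le t (B : R) : 0 <= B ->
  (forall x : config n, tv_dist (kpow (rss_kernel beta k) t x) (gibbs beta) <= B) ->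
  rss_dist n beta k t <= B.
Proof. by move=> B0 h; apply: bigmax_le => // x _; exact: h. Qed.

Lemma rss_dist_ge t (x : config n) :
  tv_dist (kpow (rss_kernel beta k) t x) (gibbs beta) <= rss_dist n beta k t.
Proof. exact: (le_bigmax _ (fun x => tv_dist (kpow (rss_kernel beta k) t x) (gibbs beta))). Qed.

Lemma rss_dist_le1 t : rss_dist n beta k t <= 1.
Proof.
have /andP[b0 _] := beta01'.
apply: rss_dist_le => // x; set mu := kpow _ _ _.
have muE y : mu y = iter t (rssE beta k) (fun z => (z == y)%:R) x.
  rewrite -kpow_sum (bigD1 y) //= eqxx mulr1 big1 ?addr0 // => z /negPf ->.
  by rewrite mulr0.
have mu0 y : 0 <= mu y by rewrite muE; apply: iter_rssE_ge.
have mu1 : \sum_y mu y = 1.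
  by under eq_bigr do rewrite -[mu _]mulr1; rewrite kpow_sum iter_rssE_cst.
have : \sum_y `|mu y - gibbs beta y| <= \sum_y mu y + \sum_(y : config n) gibbs beta y.
  rewrite -big_split; apply: ler_sum => y _; apply: (le_trans (ler_normB _ _)).
  by rewrite !ger0_norm ?gibbs_ge0.
rewrite mu1 gibbs_sum1 /tv_dist; lra.
Qed.

Lemma expR_half_ln_sqr : expR (ln n%:R / 2) ^+ 2 = n%:R :> R.
Proof. by rewrite expr2 -expRD -splitr lnK ?posrE. Qed.

(** The last [n / k] steps serve for the smoothing, with a tilt
    [delta = lam / sqrt n]; [lam] balances its entropy [lam ^ 2] against the chance
    [sqrt n / lam * kap ^ t] of not meeting. *)
Lemma upper_asym (gam : R) : k%:R <= expR (ln n%:R / 2) :> R ->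
  expR (- (c * (gam - 2) / 2)) <= 1 / 2 ->
  expR (- (c * (gam - 2) / 2)) <= pmin beta * expR (ln n%:R / 2) ->
  rss_dist n beta k (Num.truncn (tn + gam * w))
    <= expR (- (c * (gam - 2) / 2)) * (10 + 4 / pmin beta ^+ 2).
Proof.
move=> ks lam12 lamp.
have c0 := c_gt0; have n0 := nR; have k0 := kR; have pm := pmin_gt0 beta.
set s := expR (ln n%:R / 2) in ks lamp; set lam := expR _ in lam12 lamp *.
have s0 : 0 < s by exact: expR_gt0.
have lam0 : 0 < lam by exact: expR_gt0.
have s2 : s ^+ 2 = n%:R by exact: expR_half_ln_sqr.
have gam2 : 2 < gam.
  have : lam < 1 by lra.
  rewrite /lam -[X in _ < X]expR0 ltr_expR; move=> h; nra.
set T := (n %/ k)%N; set t := Num.truncn _.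
have T0 : (0 < T)%N by rewrite divn_gt0.
have Tk : (T * k <= n)%N by exact: leq_trunc_div.
have TkR : T%:R * k%:R <= n%:R :> R by rewrite -natrM ler_nat.
have Tk2 : n%:R <= 2 * (T%:R * k%:R) :> R.
  rewrite -!natrM ler_nat mul2n -addnn {1}(divn_eq n k) leq_add2l.
  by apply: leq_trans (ltnW (ltn_pmod n k_gt0)) _; rewrite leq_pmull.
have Tw : T%:R <= w by rewrite ler_pdivlMr.
have w0 : 0 < w by rewrite divr_gt0.
have L0 : 0 <= ln n%:R :> R by rewrite ln_ge0 // ler1n.
have tn0 : 0 <= tn by rewrite divr_ge0 ?mulr_ge0 // ltW.
have real0 : 0 <= tn + gam * w by rewrite addr_ge0 // mulr_ge0 //; lra.
have /andP[tlo thi] := truncn_itv real0; rewrite -/t in tlo thi.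
have gw : 2 * w <= gam * w by rewrite ler_pM2r // ltW.
have Tt : (T <= t)%N by rewrite truncn_ge_nat //; lra.
set t1 := (t - T)%N; have -> : t = (t1 + T)%N by rewrite subnK.
have t1lo : tn + (gam - 1) * w - 1 <= t1%:R.
  rewrite natrB //; move: thi; rewrite -natr1; lra.
set delta := lam / s.
have d0 : 0 < delta by rewrite divr_gt0.
have dp : delta <= pmin beta by rewrite ler_pdivrMr.
have kd : k%:R * delta <= 1.
  by rewrite mulrA ler_pdivrMr // mul1r; nra.
have lam01 : 0 < lam <= 1 / 2 by rewrite lam0.
apply: rss_dist_le => [|x].
  by rewrite mulr_ge0 ?ltW // addr_gt0 // divr_gt0 // exprn_gt0.
apply: (le_trans (@mixing_tv R n beta x beta01' n_gt0 k T delta lam k_gt0 kn d0 dp kd lam01 T0 Tk t1)).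
have e1 : T%:R * (k%:R * ((2 * delta) ^+ 2 / pmin beta ^+ 2)) / lam <= 4 / pmin beta ^+ 2 * lam.
  have -> : T%:R * (k%:R * ((2 * delta) ^+ 2 / pmin beta ^+ 2)) / lam =
      (T%:R * k%:R / n%:R) * (4 / pmin beta ^+ 2 * lam).
    by rewrite /delta -s2; field; rewrite !gt_eqF.
  rewrite -[X in _ <= X]mul1r; apply: ler_wpM2r.
    by rewrite mulr_ge0 ?divr_ge0 ?sqr_ge0 // ltW.
  by rewrite ler_pdivrMr // mul1r.
have e2 : 2 / (delta / 2 * (k%:R / n%:R) * T%:R) <= 8 * s / lam.
  have -> : 2 / (delta / 2 * (k%:R / n%:R) * T%:R) = 4 * s / lam * (n%:R / (T%:R * k%:R)).
    have T0R : T%:R != 0 :> R by rewrite pnatr_eq0 -lt0n.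
    by rewrite /delta; field; rewrite T0R !gt_eqF.
  have -> : 8 * s / lam = 4 * s / lam * 2 by ring.
  apply: ler_wpM2l; first by rewrite divr_ge0 ?mulr_ge0 // ltW.
  by rewrite ler_pdivrMr // mulr_gt0 // ltr0n.
have e3 : (1 - (1 - beta) * (k%:R / n%:R)) ^+ t1 <= lam ^+ 2 / s.
  set u := (1 - beta) * (k%:R / n%:R).
  have u1 : 0 <= 1 - u := contraction_ge0 beta01' kn.
  apply: (@le_trans _ _ (expR (- u) ^+ t1)).
    by apply: lerXn2r; rewrite ?nnegrE // ?expR_ge0 //; exact: expR_ge1Dx.
  rewrite -expRM_natl -expRM_natl -expRN -expRD ler_expR.
  have -> : t1%:R * - u = - ((1 - beta) * (k%:R / n%:R * t1%:R)) by rewrite /u; ring.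
  have : k%:R / n%:R * (tn + (gam - 1) * w - 1) <= k%:R / n%:R * t1%:R.
    by apply: ler_wpM2l => //; rewrite divr_ge0.
  have -> : k%:R / n%:R * (tn + (gam - 1) * w - 1) =
     ln n%:R / (2 * c) + (gam - 1) - k%:R / n%:R.
    by rewrite /tn /w /c; field; rewrite !gt_eqF.
  have : k%:R / n%:R <= 1 :> R by rewrite ler_pdivrMr // mul1r ler_nat.
  move=> y1 hX; set X := k%:R / n%:R * t1%:R in hX *.
  have : c * (ln n%:R / (2 * c) + (gam - 2)) <= c * X by rewrite ler_pM2l //; lra.
  rewrite mulrDr (_ : c * (ln n%:R / (2 * c)) = ln n%:R / 2); last by field; rewrite gt_eqF.
  rewrite -/c; lra.
have e4 : (1 - (1 - beta) * (k%:R / n%:R)) ^+ t1 * (2 / (delta / 2 * (k%:R / n%:R) * T%:R)) <=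
    lam ^+ 2 / s * (8 * s / lam).
  apply: ler_pM => //; first exact: exprn_ge0 (contraction_ge0 beta01' kn).
  by rewrite divr_ge0 // !mulr_ge0 ?divr_ge0 ?invr_ge0 // ltW.
have e5 : lam ^+ 2 / s * (8 * s / lam) = 8 * lam by field; rewrite !gt_eqF.
rewrite e5 in e4; apply: (le_trans (lerD (lerD (lexx (2 * lam)) e1) e4)).
by rewrite le_eqVlt; apply/orP; left; apply/eqP; ring.
Qed.

Lemma config_of_spinsum (a : nat) : (a <= n)%N ->
  exists x : config n, spinsum R x = 2 * a%:R - n%:R.
Proof.
move=> an; exists [ffun v : 'I_n => (v < a)%N].
rewrite /spinsum (eq_bigr (fun v : 'I_n => 2 * (v < a)%N%:R - 1)); last first.
  by move=> v _; rewrite ffunE /spin; case: (v < a)%N; rewrite ?mulr1 ?mulr0; ring.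
rewrite sumrB sumr_const card_ord -mulr_sumr -natr_sum; congr (2 * _%:R - _).
rewrite -[RHS]card_ord -sum1_card (big_ord_widen n (fun=> 1%N) an) [RHS]big_mkcond /=.
by apply: eq_bigr => v _; case: (v < a)%N.
Qed.

(** The magnetization [q] of the starting configuration is small enough for the
    nonlinear part of the drift to cost a factor [1 - O(q)], and large enough for
    its logarithm to cost only half of the shift [gam] of the time. *)
Lemma lower_asym (gam : R) (q := expR (- (c * gam / 2))) (C3 := 11 / c) :
  12 * k%:R ^+ 2 <= c * n%:R -> 2 <= q * n%:R -> 2 * c * gam <= ln n%:R ->
  c * k%:R * ln n%:R <= n%:R -> 12 * k%:R ^+ 2 * ln n%:R <= c * n%:R * q ->
  k%:R <= expR (ln n%:R / 2) :> R -> q <= 1 / 2 ->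
  1 - q * (4 + 128 / c + 8 * C3 * expR 1 ^+ 2 + 8 * ((2 * C3 + 21) / c) * expR 1)
    <= rss_dist n beta k (Num.truncn (tn - gam * w)).
Proof.
move=> h1 h2 h3 h4 h5 ks q12.
have c0 := c_gt0; have n0 := nR; have k0 := kR; have /andP[b0 b1] := beta01.
have k1 : 1 <= k%:R :> R by rewrite ler1n.
have q0 : 0 < q by exact: expR_gt0.
set s := expR (ln n%:R / 2) in ks.
have s0 : 0 < s by exact: expR_gt0.
have s2 : s ^+ 2 = n%:R by exact: expR_half_ln_sqr.
have C30 : 0 < C3 by rewrite divr_gt0.
have ks2 : k%:R ^+ 2 <= n%:R :> R by rewrite -s2; apply: lerXn2r; rewrite ?nnegrE // ltW.
have L0 : 0 <= ln n%:R :> R by rewrite ln_ge0 // ler1n.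
set L := ln n%:R in h3 h4 h5 L0 s s0 s2 ks *.
(* a starting configuration with magnetization between q and 2 q *)
set a := Num.truncn ((1 + 2 * q) * n%:R / 2).
have a0 : 0 <= (1 + 2 * q) * n%:R / 2 by rewrite divr_ge0 // mulr_ge0 //; lra.
have /andP[alo ahi] := truncn_itv a0; rewrite -/a in alo ahi.
have an : (a <= n)%N.
  rewrite -(ler_nat R); apply: (le_trans alo).
  have : 2 * q * n%:R <= 1 * n%:R by apply: ler_wpM2r; lra.
  lra.
have [x Nx] := config_of_spinsum an.
have Nlo : q * n%:R <= spinsum R x by rewrite Nx; move: ahi; rewrite -[a.+1%:R]natr1; lra.
have Nhi : spinsum R x <= 2 * q * n%:R by rewrite Nx; lra.
have N0 : 0 < spinsum R x by apply: lt_le_trans Nlo; rewrite mulr_gt0.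
set t := Num.truncn _.
have w0 : 0 < w by rewrite divr_gt0.
have tnE : tn = w * (L / (2 * c)) by rewrite /tn /w /c /L; field; rewrite !gt_eqF.
have real0 : 0 <= tn - gam * w.
  have : gam <= L / (2 * c) by rewrite ler_pdivlMr ?mulr_gt0 //; lra.
  rewrite tnE (mulrC w) -mulrBl => h; rewrite mulr_ge0 //; lra.
have /andP[thi _] := truncn_itv real0; rewrite -/t in thi.
set u := (1 - beta) * (k%:R / n%:R).
have wk : w * (k%:R / n%:R) = 1 by rewrite /w; field; rewrite !gt_eqF.
have u0 : 0 < u by rewrite mulr_gt0 ?divr_gt0.
have kn0 : 0 <= k%:R / n%:R :> R by rewrite divr_ge0.
have tk : t%:R * (k%:R / n%:R) <= L / (2 * c) - gam.
  have := ler_wpM2r kn0 thi; rewrite tnE.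
  have -> : (w * (L / (2 * c)) - gam * w) * (k%:R / n%:R) =
    (w * (k%:R / n%:R)) * (L / (2 * c) - gam) by ring.
  by rewrite wk mul1r.
have tu : t%:R * u <= L / 2 - c * gam.
  have -> : t%:R * u = c * (t%:R * (k%:R / n%:R)) by rewrite /u /c; ring.
  have -> : L / 2 - c * gam = c * (L / (2 * c) - gam) by field; rewrite gt_eqF.
  by rewrite ler_pM2l.
have gam0 : 0 < gam.
  have : q < 1 by lra.
  rewrite /q -[X in _ < X]expR0 ltr_expR => h.
  by rewrite -(pmulr_rgt0 _ c0); lra.
have cg0 : 0 < c * gam by rewrite mulr_gt0.
have tu0 : 0 <= t%:R * u by rewrite mulr_ge0 // ltW.
have u12 : u <= 1 / 12.
  have ck : c * k%:R <= k%:R ^+ 2.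
    by rewrite expr2 ler_pM2r //; rewrite /c; lra.
  have cn : c * n%:R <= 1 * n%:R by rewrite ler_pM2r // /c; lra.
  rewrite /u -/c mulrA ler_pdivrMr //; lra.
have uL : u * L <= 1.
  by rewrite /u -/c mulrA mulrAC ler_pdivrMr // mul1r.
set kap := 1 - u.
have kap0 : 0 < kap by rewrite /kap; lra.
have u01 : 0 < u <= 1 / 12 by rewrite u0.
have kapt : expR (- (L / 2) + c * gam - 1) <= kap ^+ t := power_lower u01 (ltW cg0) tu uL.
have mu_ge : s * (expR 1)^-1 * q^-1 <= kap ^+ t * spinsum R x.
  have e : s * (expR 1)^-1 * q^-1 = expR (- (L / 2) + c * gam - 1) * (q * n%:R).
    rewrite -s2 /s /q -!expRN -!expRM_natl -!expRD; congr expR.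
    by move: (c * gam) (L / 2) => X Y; field.
  rewrite e; apply: ler_pM => //; first by rewrite ?expR_ge0 ?mulr_ge0 ?ltW.
have hr : (1 - 2 * u + 6 * k%:R ^+ 3 / n%:R ^+ 2) ^+ t <= (1 + q) * kap ^+ (2 * t).
  have -> : 6 * k%:R ^+ 3 / n%:R ^+ 2 = 1 / 2 * (12 * k%:R ^+ 3 / n%:R ^+ 2) :> R.
    by field; rewrite gt_eqF.
  have y0 : 0 <= 12 * k%:R ^+ 3 / n%:R ^+ 2 :> R.
    by rewrite divr_ge0 // mulr_ge0 // exprn_ge0.
  have q01 : 0 < q <= 1 / 2 by rewrite q0.
  apply: (power_ratio u01 y0 q01).
  have -> : t%:R * (12 * k%:R ^+ 3 / n%:R ^+ 2) = 12 * k%:R ^+ 2 / n%:R * (t%:R * (k%:R / n%:R)) :> R.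
    by field; rewrite gt_eqF.
  have kk0 : 0 <= 12 * k%:R ^+ 2 / n%:R :> R by rewrite divr_ge0 ?mulr_ge0 ?exprn_ge0 // ltW.
  apply: (@le_trans _ _ (12 * k%:R ^+ 2 / n%:R * (L / (2 * c)))).
    by apply: ler_wpM2l => //; apply: (le_trans tk); rewrite gerBl ltW.
  have -> : 12 * k%:R ^+ 2 / n%:R * (L / (2 * c)) = (12 * k%:R ^+ 2 * L) / (2 * c * n%:R).
    by field; rewrite !gt_eqF.
  rewrite ler_pdivrMr ?mulr_gt0 // (_ : q / 2 * (2 * c * n%:R) = c * n%:R * q) //.
  by field.
have := @lower_tv R n beta beta01' k k_gt0 kn ks2 b1 h1 t x q N0 hr.
rewrite -/u -/kap -/c -/C3 => lo.
apply: le_trans (rss_dist_ge t x); apply: le_trans lo; rewrite lerD2l lerN2.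
have e1_0 : 0 < expR 1 :> R by exact: expR_gt0.
have mu0 : 0 < kap ^+ t * spinsum R x by exact: mulr_gt0 (exprn_gt0 _ kap0) N0.
have hN : spinsum R x / n%:R <= 2 * q by rewrite ler_pdivrMr.
have hX : s / (kap ^+ t * spinsum R x) <= expR 1 * q.
  rewrite ler_pdivrMr //; apply: le_trans (ler_wpM2l (ltW (mulr_gt0 e1_0 q0)) mu_ge).
  by rewrite le_eqVlt; apply/orP; left; apply/eqP; field; rewrite !gt_eqF.
exact: (lower_error c0 C30 q0 q12 s0 s2 k1 ks e1_0 mu0 hN hX).
Qed.


End FiniteBounds.

(** * Passage to the limit *)

Section Limits.
Variable R : realType.

Lemma limn_esup_le_near (u : nat -> \bar R) (b : \bar R) :
  (\forall n \near \oo, (u n <= b)%E) -> (limn_esup u <= b)%E.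
Proof.
move=> hu; rewrite /limn_esup limf_esupE.
apply: (@le_trans _ _ (ereal_sup [set u x | x in [set n | (u n <= b)%E]])).
  by apply: ereal_inf_lbound; exists [set n | (u n <= b)%E].
by apply: ge_ereal_sup => _ [n hn <-].
Qed.

Lemma limn_einf_ge_near (u : nat -> \bar R) (a : \bar R) :
  (\forall n \near \oo, (a <= u n)%E) -> (a <= limn_einf u)%E.
Proof.
move=> hu; rewrite -[u](_ : (-%E \o (-%E \o u)) = u); last first.
  by apply: funext => n /=; rewrite oppeK.
rewrite limn_einfN leeNr; apply: limn_esup_le_near.
by apply: filterS hu => n /= h; rewrite leeN2.
Qed.

Lemma limn_einf_esup_between (u : nat -> R) (a b : R) :
  (\forall n \near \oo, a <= u n <= b) ->
  ((a%:E <= limn_einf (fun n => (u n)%:E))%E /\ (limn_einf (fun n => (u n)%:E) <= b%:E)%E) /\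
  ((a%:E <= limn_esup (fun n => (u n)%:E))%E /\ (limn_esup (fun n => (u n)%:E) <= b%:E)%E).
Proof.
move=> hu.
have lo : (a%:E <= limn_einf (fun n => (u n)%:E))%E.
  by apply: limn_einf_ge_near; apply: filterS hu => n /andP[h _]; rewrite lee_fin.
have hi : (limn_esup (fun n => (u n)%:E) <= b%:E)%E.
  by apply: limn_esup_le_near; apply: filterS hu => n /andP[_ h]; rewrite lee_fin.
have mid := limn_einf_sup (fun n => (u n)%:E).
by split; split => //; [exact: le_trans mid hi|exact: le_trans lo mid].
Qed.

Lemma cvg_ereal_sandwich (f : R -> \bar R) (l : R) :
  (forall e, 0 < e -> \forall g \near +oo, ((l - e)%:E <= f g)%E /\ (f g <= (l + e)%:E)%E) ->
  f g @[g --> +oo] --> l%:E.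
Proof.
move=> hf; have fin g e : ((l - e)%:E <= f g)%E /\ (f g <= (l + e)%:E)%E ->
    f g \is a fin_num /\ `|l - fine (f g)| <= e.
  case: (f g) => [r||] [] //=; rewrite !lee_fin => h1 h2; split => //.
  by rewrite ler_norml; apply/andP; split; lra.
apply/fine_cvgP; split.
  by apply: filterS (hf 1 ltr01) => g /fin[].
apply/cvgrPdist_le => e e0; apply: filterS (hf e e0) => g /fin[_].
exact.
Qed.

Lemma near_ln_ge (M : R) : \forall n \near \oo, M <= ln (n%:R : R).
Proof.
exists (Num.truncn (expR M)).+1 => // n /= hn.
have h : expR M <= n%:R.
  apply: ltW; apply: lt_le_trans (_ : (Num.truncn (expR M)).+1%:R <= _); last by rewrite ler_nat.
  by have /andP[] := truncn_itv (expR_ge0 M).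
by rewrite -[M]expRK ler_ln ?posrE ?expR_gt0 // (lt_le_trans (expR_gt0 M)).
Qed.

Lemma expRN_le (e x : R) : 0 < e -> e^-1 <= x -> expR (- x) <= e.
Proof.
move=> e0 ex; have ei : 0 < e^-1 by rewrite invr_gt0.
rewrite expRN -[e]invrK lef_pV2 ?posrE ?expR_gt0 //.
by have := expR_ge1Dx x; lra.
Qed.

(** Here [expR L] stands for [n], and the hypothesis on [K] says [K <= n ^ (1/3)]. *)
Lemma regime (c q L K : R) : 0 < c <= 1 -> 0 < q <= 1 -> 0 <= K -> K <= expR (L / 3) ->
  9 <= L -> 36 / c <= L -> 2 / q <= L -> 432 / (c * q) <= L ->
  [/\ 12 * K ^+ 2 <= c * expR L, 2 <= q * expR L, c * K * L <= expR L,
      12 * K ^+ 2 * L <= c * expR L * q & K <= expR (L / 2)].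
Proof.
move=> /andP[c0 c1] /andP[q0 q1] K0 Kz L9 Lc Lq Lcq.
set z := expR (L / 3) in Kz.
have zL : 1 + L / 3 <= z by exact: expR_ge1Dx.
have z3 : expR L = z ^+ 3 by rewrite -expRM_natl; congr expR; field.
have z0 : 0 < z by exact: expR_gt0.
have Kz2 : K ^+ 2 <= z ^+ 2 by apply: lerXn2r; rewrite ?nnegrE // ltW.
have z20 : 0 <= z ^+ 2 by exact: sqr_ge0.
have zq : 12 * L <= c * q * z.
  have h : (1 + L / 6) ^+ 2 <= z.
    rewrite (_ : z = expR (L / 6) ^+ 2); last first.
      by rewrite -expRM_natl; congr expR; field.
    by apply: lerXn2r; rewrite ?nnegrE ?expR_ge0 //; [lra|exact: expR_ge1Dx].
  have cq0 : 0 < c * q by rewrite mulr_gt0.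
  move: Lcq; rewrite ler_pdivrMr // => Lcq.
  have h2 : c * q * (L ^+ 2 / 36) <= c * q * z.
    by rewrite ler_pM2l //; apply: le_trans h; nra.
  apply: le_trans h2.
  have : 432 * L <= L * (c * q) * L by rewrite ler_pM2r //; lra.
  lra.
split.
- have : 12 * K ^+ 2 <= 12 * z ^+ 2 by rewrite ler_pM2l.
  have h12 : 12 <= c * z.
    move: Lc; rewrite ler_pdivrMr // => Lc.
    have : c * (1 + L / 3) <= c * z by rewrite ler_pM2l.
    lra.
  have := ler_wpM2r z20 h12.
  by rewrite z3 exprSr; lra.
- have := expR_ge1Dx L; move: Lq; rewrite ler_pdivrMr // => Lq h.
  have : q * (1 + L) <= q * expR L by rewrite ler_pM2l.
  lra.
- have cK : c * K <= z.
    by rewrite -[X in _ <= X]mul1r; apply: ler_pM => //; exact: ltW.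
  have : c * K * L <= z * L by apply: ler_wpM2r; lra.
  have zz : z * L <= z * (3 * z) by rewrite ler_pM2l //; lra.
  have : z ^+ 2 * 3 <= z ^+ 2 * z by apply: ler_wpM2l => //; lra.
  rewrite z3; lra.
- have : 12 * L * K ^+ 2 <= c * q * z * z ^+ 2.
    by apply: ler_pM => //; [lra|exact: sqr_ge0].
  rewrite z3; lra.
by apply: (le_trans Kz); rewrite ler_expR; lra.
Qed.

End Limits.

Section Cutoff.
Variables (R : realType) (beta : R) (k : nat -> nat).
Hypothesis hbeta : 0 < beta < 1.
Hypothesis hk : forall n : nat, (0 < n)%N -> (1 <= k n <= n)%N.
Hypothesis hko : \forall n \near \oo, (k n)%:R <= expR (ln (n%:R : R) / 3).

Let c : R := 1 - beta.
Let d (n t : nat) : R := rss_dist n beta (k n) t.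
Let tn (n : nat) : R := n%:R * ln n%:R / (2 * (k n)%:R * (1 - beta)).
Let wn (n : nat) : R := n%:R / (k n)%:R.

Let c01 : 0 < c <= 1.
Proof. by case/andP: hbeta => b0 b1; apply/andP; split; rewrite /c; lra. Qed.

Lemma window_little_o (e : R) : 0 < e -> \forall n \near \oo, `|wn n| <= e * `|tn n|.
Proof.
move=> e0; have /andP[c0 c1] := c01.
near=> n.
have n0 : (0 < n)%N by near: n; exists 1%N.
have /andP[k0 kn] := hk n0.
have nR : 0 < n%:R :> R by rewrite ltr0n.
have kR : 0 < (k n)%:R :> R by rewrite ltr0n.
have L : 2 * c / e <= ln n%:R by near: n; exact: near_ln_ge.
have L0 : 0 < ln (n%:R : R) by apply: lt_le_trans L; rewrite divr_gt0 // mulr_gt0.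
rewrite !ger0_norm ?divr_ge0 ?mulr_ge0 ?(ltW c0) ?(ltW L0) //.
have -> : e * tn n = wn n * (e * ln n%:R / (2 * c)).
  by rewrite /tn /wn /c; field; rewrite !gt_eqF.
rewrite ler_peMr ?divr_ge0 // ler_pdivlMr ?mulr_gt0 // mul1r.
by move: L; rewrite ler_pdivrMr // [ln _ * e]mulrC.
Unshelve. all: by end_near. Qed.

Lemma upper_near (gam : R) : expR (- (c * (gam - 2) / 2)) <= 1 / 2 ->
  \forall n \near \oo, 0 <= d n (Num.truncn (tn n + gam * wn n)) <=
    expR (- (c * (gam - 2) / 2)) * (10 + 4 / pmin beta ^+ 2).
Proof.
move=> lam12; have pm := pmin_gt0 beta.
near=> n.
have n0 : (0 < n)%N by near: n; exists 1%N.
have /andP[k0 kn] := hk n0.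
have L : 0 <= ln (n%:R : R) by near: n; exact: near_ln_ge.
have L' : (pmin beta)^-1 * 2 <= ln (n%:R : R) by near: n; exact: near_ln_ge.
have kz : (k n)%:R <= expR (ln (n%:R : R) / 3) by near: n.
apply/andP; split; first exact: rss_dist_ge0.
apply: upper_asym => //.
  by apply: (le_trans kz); rewrite ler_expR; lra.
apply: (le_trans lam12); rewrite -ler_pdivrMl //.
have := expR_ge1Dx (ln (n%:R : R) / 2); lra.
Unshelve. all: by end_near. Qed.

Definition lower_const : R :=
  4 + 128 / (1 - beta) + 8 * (11 / (1 - beta)) * expR 1 ^+ 2
  + 8 * ((2 * (11 / (1 - beta)) + 21) / (1 - beta)) * expR 1.

Lemma lower_near (gam : R) : expR (- (c * gam / 2)) <= 1 / 2 ->
  \forall n \near \oo, 1 - expR (- (c * gam / 2)) * lower_const <=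
     d n (Num.truncn (tn n - gam * wn n)) <= 1.
Proof.
move=> q12; set q := expR _ in q12 *.
have q0 : 0 < q by exact: expR_gt0.
have q01 : 0 < q <= 1 by apply/andP; split; lra.
near=> n.
have n0 : (0 < n)%N by near: n; exists 1%N.
have /andP[k0 kn] := hk n0.
have L1 : 9 <= ln (n%:R : R) by near: n; exact: near_ln_ge.
have L2 : 36 / c <= ln (n%:R : R) by near: n; exact: near_ln_ge.
have L3 : 2 / q <= ln (n%:R : R) by near: n; exact: near_ln_ge.
have L4 : 432 / (c * q) <= ln (n%:R : R) by near: n; exact: near_ln_ge.
have L5 : 2 * c * gam <= ln (n%:R : R) by near: n; exact: near_ln_ge.
have kz : (k n)%:R <= expR (ln (n%:R : R) / 3) by near: n.
apply/andP; split; last exact: rss_dist_le1.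
have := regime c01 q01 (ler0n R (k n)) kz L1 L2 L3 L4.
rewrite lnK ?posrE ?ltr0n // => -[h1 h2 h3 h4 h5].
exact: lower_asym.
Unshelve. all: by end_near. Qed.

Lemma cutoff_rss : cutoff d tn wn.
Proof.
have /andP[c0 c1] := c01; have pm := pmin_gt0 beta.
have small (C e g0 : R) : 0 < C -> 0 < e ->
    \forall g \near +oo, expR (- (c * (g - g0) / 2)) <= 1 / 2 /\
      expR (- (c * (g - g0) / 2)) * C <= e.
  move=> C0 e0.
  have large (M : R) : \forall g \near +oo, M <= c * (g - g0) / 2.
    have h : g0 + 2 * M / c \is Num.real by exact: num_real.
    apply: filterS (nbhs_pinfty_ge h) => g hg.
    have : 2 * M / c <= g - g0 by lra.
    by rewrite ler_pdivrMr //; lra.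
  have h2 : 0 < 1 / 2 :> R by lra.
  apply: filterS2 (large (1 / 2)^-1) (large (e / C)^-1) => g ga gb; split.
    exact: expRN_le.
  by rewrite -ler_pdivlMr //; apply: expRN_le => //; rewrite divr_gt0.
split.
- by apply/eqoP => e e0; exact: window_little_o.
- have C0 : 0 < lower_const.
    have e1 := expR_gt0 (1 : R).
    have ci : 0 < (1 - beta)^-1 by rewrite invr_gt0.
    by rewrite /lower_const !addr_gt0 ?mulr_gt0 ?addr_gt0 ?mulr_gt0 ?exprn_gt0.
  apply: cvg_ereal_sandwich => e e0.
  apply: filterS (small _ _ 0 C0 e0) => g; rewrite subr0 => -[g1 g2].
  have [[l1 l2] _] := limn_einf_esup_between (lower_near g1).
  split; first by apply: le_trans l1; rewrite lee_fin; lra.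
  by apply: (le_trans l2); rewrite lee_fin; lra.
have C0 : 0 < 10 + 4 / pmin beta ^+ 2 by rewrite addr_gt0 // divr_gt0 // exprn_gt0.
apply: cvg_ereal_sandwich => e e0.
apply: filterS (small _ _ 2 C0 e0) => g [g1 g2].
have [_ [u1 u2]] := limn_einf_esup_between (upper_near g1).
split; first by apply: le_trans u1; rewrite lee_fin; lra.
by apply: (le_trans u2); rewrite lee_fin; lra.
Qed.

End Cutoff.

Unset Implicit Arguments.

Theorem theorem1p1 (R : realType) (beta : R) (k : nat -> nat)
    (hbeta : 0 < beta < 1)
    (hk : forall n : nat, (0 < n)%N -> (1 <= k n <= n)%N)
    (hko : (fun n : nat => (k n)%:R : R) =o_\oo (fun n : nat => n%:R `^ (1 / 3) : R)) :
  cutoff (fun n t : nat => rss_dist n beta (k n) t)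
    (fun n : nat => n%:R * ln n%:R / (2 * (k n)%:R * (1 - beta)))
    (fun n : nat => n%:R / (k n)%:R).
Proof.
apply: cutoff_rss => //.
move/eqoP: hko => /(_ 1 ltr01) h.
near=> n.
have n0 : (n%:R : R) != 0 by rewrite pnatr_eq0 -lt0n; near: n; exists 1%N.
have : `|(k n)%:R : R| <= 1 * `|n%:R `^ (1 / 3) : R| by near: n.
rewrite mul1r normr_nat /powR (negPf n0) ger0_norm ?expR_ge0 //.
by rewrite mulrC mulrA mulr1.
Unshelve. all: by end_near. Qed.
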